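(* Consider the triangular system $$\dot x_1=g_1(t,x_1,x_2,\ldots,x_n),\quad \dot x_2=g_2(t,x_2,\ldots,x_n),\quad\ldots,\quad \dot x_n=g_n(t,x_n),$$ with $x_i\in\mathbb{R}$, $t\in\mathbb{R}^+$, and let $G\colon\mathbb{R}^+\times\mathbb{R}^n\to\mathbb{R}^n$, $G(t,x)=(g_1(t,x_1,\ldots,x_n),\ldots,g_n(t,x_n))$ denote its right-hand side. Suppose that: (G1) $G(t,x)$ is continuous with respect to $t$ and $C^1$ with respect to $x$. (G2) For all $t\ge0$: $G(t,x)=0$ if and only if $x=0$. (G3) For any measurable function $y\colon\mathbb{R}^+\to\mathbb{R}^n$, the Jacobian matrix $JG(t,y(t))$ is bounded on $\mathbb{R}^+$. (G4) For any measurable function $y\colon\mathbb{R}^+\to\mathbb{R}^n$, the linear system $\dot z=JG(t,y(t))z$ has exponential dichotomy spectrum satisfying $\Sigma^+(JG(t,y(t)))\subset(-\infty,0)$. Then the trivial solution of the triangular system is globally uniformly asymptotically stable.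
   Context: $\mathbb{R}^+=[0,+\infty)$. $JG(t,x)$ is the Jacobian matrix of $G$ with respect to $x$. Exponential dichotomy: let $J\subset\mathbb{R}$ be an interval and $t\mapsto A(t)\in\mathbb{R}^{n\times n}$ locally integrable on $J$. The system $\dot x=A(t)x$, with fundamental matrix $\Phi(t)$, has an exponential dichotomy on $J$ if there exist a projection $P=P^2$ and constants $K\ge1$, $\alpha>0$ such that $\|\Phi(t)P\Phi^{-1}(s)\|\le Ke^{-\alpha(t-s)}$ for all $t\ge s$, $t,s\in J$, and $\|\Phi(t)(I-P)\Phi^{-1}(s)\|\le Ke^{-\alpha(s-t)}$ for all $s\ge t$, $t,s\in J$. Exponential dichotomy spectrum: $\Sigma^+(A)=\{\gamma\in\mathbb{R}\colon \dot x=[A(t)-\gamma I]x$ does not have an exponential dichotomy on $[0,+\infty)\}$. Class $\mathcal{KL}$: a function $\beta\colon\mathbb{R}^+\times\mathbb{R}^+\to\mathbb{R}^+$ is in $\mathcal{KL}$ if for each fixed $r\ge0$ the map $s\mapsto\beta(s,r)$ is strictly increasing with $\beta(0,r)=0$, and for each fixed $s$ the map $r\mapsto\beta(s,r)$ is decreasing and tends to $0$ as $r\to\infty$. Stability: for $\dot x=g(t,x)$ with $g(t,0)=0$ for all $t\ge0$, the equilibrium $x=0$ is uniformly asymptotically stable if there exist $\beta\in\mathcal{KL}$ and $c>0$, independent of $t_0$, such that $|x(t)|\le\beta(|x(t_0)|,t-t_0)$ for all $t\ge t_0\ge0$ and all solutions with $|x(t_0)|<c$. It is globally uniformly asymptotically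 stable if there is $\beta\in\mathcal{KL}$ for which this estimate holds for all $t\geq t_0\geq 0$ and all initial values $x(t_0)$ (no restriction by $c$). *)

(* Defs.v *)
From HB Require Import structures.
From mathcomp Require Import all_boot all_order all_algebra.
From mathcomp Require Import all_classical all_reals all_analysis.
Import Order.TTheory GRing.Theory Num.Theory.
Import numFieldNormedType.Exports.

Set Implicit Arguments.
Unset Strict Implicit.
Unset Printing Implicit Defensive.

Local Open Scope classical_set_scope.
Local Open Scope ring_scope.

(* Points of R^n are row vectors, linear systems act on columns.  `|.| is the
   library's max norm on vectors and matrices; the notions below only involve
   norms up to a multiplicative constant (absorbed by K in a dichotomy and by
   beta in a stability estimate). *)

(* [jacobian] is laid out for the action v *m J on row vectors; the transpose
   has the usual layout, with entry (i, j) equal to d G_i / d x_j. *)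
Definition Jac (R : realType) (n : nat) (G : R -> 'rV[R]_n -> 'rV[R]_n)
  (t : R) (x : 'rV[R]_n) : 'M[R]_n := ('J (G t) x)^T.

(* The i-th component depends only on t and x_i, ..., x_n. *)
Definition triangular (R : realType) (n : nat)
    (G : R -> 'rV[R]_n -> 'rV[R]_n) : Prop :=
  forall (t : R) (i : 'I_n) (x y : 'rV[R]_n), 0 <= t ->
    (forall j : 'I_n, (i <= j)%N -> x ord0 j = y ord0 j) ->
    G t x ord0 i = G t y ord0 i.

Definition C1 (R : realType) (n : nat) (f : 'rV[R]_n -> 'rV[R]_n) : Prop :=
  (forall x : 'rV[R]_n, differentiable f x) /\
  continuous (fun x : 'rV[R]_n => 'J f x).

(* Borel measurability, componentwise.  A hypothesis over all Borel functions y
   is implied by the same hypothesis over all Lebesgue measurable ones. *)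
Definition measurable_vector (R : realType) (n : nat) (D : set R)
    (y : R -> 'rV[R]_n) : Prop :=
  forall j : 'I_n, measurable_fun D (fun t : R => y t ord0 j).

(* The library's [locally_integrable] is restricted to open sets, hence this
   version for an interval J that may contain its endpoints. *)
Definition loc_integrable_mx (R : realType) (n : nat) (J : interval R)
    (A : R -> 'M[R]_n) : Prop :=
  forall a b : R, a \in J -> b \in J -> forall i j : 'I_n,
    (@lebesgue_measure R).-integrable `[a, b] (fun t : R => (A t i j)%:E).

(* As A is only locally integrable, x' = A(t) x is understood in the sense of
   Caratheodory, i.e. through the integral equation. *)
Definition fundamental_matrix (R : realType) (n : nat) (J : interval R)
    (A Phi : R -> 'M[R]_n) : Prop :=
  [/\ {within [set` J], continuous Phi},
      forall t : R, t \in J -> Phi t \in unitmx &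
      forall s t : R, s \in J -> t \in J -> s <= t -> forall i j : 'I_n,
        Phi t i j = Phi s i j +
          \int[@lebesgue_measure R]_(u in `[s, t]) (A u *m Phi u) i j].

Definition exp_dichotomy (R : realType) (n : nat) (J : interval R)
    (A : R -> 'M[R]_n) : Prop :=
  loc_integrable_mx J A /\
  exists (Phi : R -> 'M[R]_n) (P : 'M[R]_n) (K alpha : R),
    [/\ fundamental_matrix J A Phi, P *m P = P, 1 <= K /\ 0 < alpha,
        forall s t : R, s \in J -> t \in J -> s <= t ->
          `|Phi t *m P *m invmx (Phi s)| <= K * expR (- alpha * (t - s)) &
        forall s t : R, s \in J -> t \in J -> t <= s ->
          `|Phi t *m (1%:M - P) *m invmx (Phi s)|
            <= K * expR (- alpha * (s - t))].

Definition ED_spectrum (R : realType) (n : nat) (A : R -> 'M[R]_n) : set R :=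
  [set gamma : R | ~ exp_dichotomy `[0, +oo[ (fun t : R => A t - gamma%:M)].

(* Only the values of beta on R^+ x R^+ matter.  "Decreasing" is meant in the
   wide sense, as forced by beta(0, r) = 0. *)
Definition class_KL (R : realType) (beta : R -> R -> R) : Prop :=
  [/\ forall s r : R, 0 <= s -> 0 <= r -> 0 <= beta s r,
      forall r : R, 0 <= r -> beta 0 r = 0,
      forall r s1 s2 : R, 0 <= r -> 0 <= s1 -> s1 < s2 ->
        beta s1 r < beta s2 r,
      forall s r1 r2 : R, 0 <= s -> 0 <= r1 -> r1 <= r2 ->
        beta s r2 <= beta s r1 &
      forall s : R, 0 <= s -> beta s r @[r --> +oo] --> (0 : R)].

(* x solves x' = g(t, x) on [t0, T[, where T may be +oo.  At t0 only
   continuity is asked for; the right derivative then exists there as soon as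
   t |-> g t (x t) is right continuous at t0. *)
Definition solution (R : realType) (n : nat) (g : R -> 'rV[R]_n -> 'rV[R]_n)
    (t0 : R) (T : \bar R) (x : R -> 'rV[R]_n) : Prop :=
  {within [set t : R | t0 <= t /\ (t%:E < T)%E], continuous x} /\
  forall t : R, t0 < t -> (t%:E < T)%E ->
    is_derive t (1 : R) x (g t (x t)).

(* The estimate is required along every solution, at every time of its
   interval of existence, and not only along those assumed to be defined on
   all of [t0, +oo[; in particular it excludes finite-time blow-up. *)
Definition globally_uniformly_asymptotically_stable (R : realType) (n : nat)
    (g : R -> 'rV[R]_n -> 'rV[R]_n) : Prop :=
  exists beta : R -> R -> R, class_KL beta /\
    forall (t0 : R) (T : \bar R) (x : R -> 'rV[R]_n), 0 <= t0 ->
      solution g t0 T x ->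
      forall t : R, t0 <= t -> (t%:E < T)%E ->
        `|x t| <= beta `|x t0| (t - t0).

(* Main.v *)
Require Import Defs.
From HB Require Import structures.
From mathcomp Require Import all_boot all_order all_algebra.
From mathcomp Require Import all_classical all_reals all_analysis.
From mathcomp Require Import measurable_realfun ring lra.
Import Order.TTheory GRing.Theory Num.Theory.
Import numFieldNormedType.Exports.

Local Open Scope classical_set_scope.
Local Open Scope ring_scope.

(** The idea.  By (G3) the Jacobian is bounded uniformly in t and x, so G is
    globally Lipschitz in x; by (G4) and triangularity each diagonal entry
    a_i(t, x) of the Jacobian has, along every measurable y, integrals bounded
    by K - alpha (t - s).  As (G4) covers all measurable y at once, it may be
    applied to a y that almost maximizes x |-> a_i(t, x) at every t: this gives
    one measurable p with a_i(t, x) <= p(t) for all x and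
    \int_s^t p <= K - alpha (t - s) ([diagonal_exponent]), that is, constants
    that no longer depend on y.  Along a solution the mean value theorem in the
    direction of x_i gives
      (x_i^2)' <= (2 p + alpha) x_i^2 + (L^2 / alpha) max_(j > i) x_j^2,
    and Gronwall's lemma transports exponential decay from the components j > i
    to the component i ([component_decay]).  Starting from the last component,
    all of them decay exponentially, with constants independent of the solution
    and of t0, and beta(s, r) = C s exp(- delta r) is the required function.

    Why the diagonal is stable.  For every gamma >= 0 the linear system shifted
    by gamma has a dichotomy.  If some projection differed from the identity,
    consider the supremum of the gamma for which some solution grows faster than
    exp(gamma t).  A dichotomy at this supremum either has projection identity,
    and then all solutions grow at a strictly smaller rate, or it has a solution
    growing at a strictly larger rate; both are absurd
    ([uniformly_stable_of_dichotomies]).  So the system itself is uniformly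
    exponentially stable, and its transition matrix is upper triangular with
    diagonal entries exp(\int_s^t a_i) ([triangular_solution_diag]).

    Measurable coefficients.  The linear systems are only measurable in time, so
    their solutions are not differentiable everywhere.  With
    B(s, t) = \int_s^t A, a solution satisfies
    |Z(t) - Z(s) - B(s, t) Z(s)| <= C (t - s)^2 on bounded intervals, and this
    estimate determines it: a function whose increments are bounded by
    C (t - s)^2 is nonincreasing ([quadratic_nonincreasing]).  Working with this
    estimate ([quad_solution]) turns uniqueness, exponential shifts and
    Gronwall's lemma into elementary algebra. *)

(** * Comparison of functions up to quadratic errors *)

(** Over N equal steps the errors add up to C (b - a)^2 / N, which tends to 0. *)
Lemma quadratic_nonincreasing {R : realType} (H : R -> R) (a b C : R) :
  a <= b ->
  (forall s t, a <= s -> s <= t -> t <= b -> H t - H s <= C * (t - s) ^+ 2) ->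
  H b <= H a.
Proof.
move=> ab HC; rewrite leNgt; apply/negP => Hab.
have step (N : nat) : (0 < N)%N -> (H b - H a) * N%:R <= C * (b - a) ^+ 2.
  move=> N0; pose h := (b - a) / N%:R.
  have N0' : 0 < N%:R :> R by rewrite ltr0n.
  have h0 : 0 <= h by rewrite divr_ge0 ?subr_ge0 // ltW.
  have hN : N%:R * h = b - a by rewrite mulrC divfK // gt_eqF.
  have ind k : (k <= N)%N -> H (a + k%:R * h) - H a <= k%:R * (C * h ^+ 2).
    elim: k => [_|k IH kN]; first by rewrite !mul0r addr0 subrr.
    have := IH (ltnW kN).
    have kh : k.+1%:R * h <= N%:R * h by rewrite ler_wpM2r // ler_nat.
    have kh0 : 0 <= k%:R * h by rewrite mulr_ge0.
    have h1 : a <= a + k%:R * h by lra.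
    have h2 : a + k%:R * h <= a + k.+1%:R * h by rewrite -natr1; lra.
    have h3 : a + k.+1%:R * h <= b by lra.
    have := HC _ _ h1 h2 h3.
    rewrite -natr1.
    have -> : a + (k%:R + 1) * h - (a + k%:R * h) = h by ring.
    lra.
  have := ind N (leqnn _); rewrite hN subrKC => le1.
  have -> : C * (b - a) ^+ 2 = N%:R * (C * h ^+ 2) * N%:R by rewrite -hN; ring.
  by rewrite ler_wpM2r // ltW.
have e0 : 0 < H b - H a by rewrite subr_gt0.
have := step (Num.truncn `|C * (b - a) ^+ 2 / (H b - H a)|).+1 isT.
rewrite leNgt => /negP; apply.
rewrite -ltr_pdivrMl // mulrC.
by apply: le_lt_trans (ler_norm _) _; exact: truncnS_gt.
Qed.

Lemma expRN_le_quad {R : realType} (u : R) : 0 <= u ->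
  expR (- u) <= 1 - u + u ^+ 2.
Proof.
move=> u0; rewrite expRN.
have e1 := expR_ge1Dx u.
have q0 : 0 <= 1 - u + u ^+ 2 by nra.
rewrite -[leLHS]mul1r ler_pdivrMr ?expR_gt0 //.
apply: (@le_trans _ _ ((1 - u + u ^+ 2) * (1 + u))); last exact: ler_wpM2l.
have : 0 <= u ^+ 3 by rewrite exprn_ge0.
lra.
Qed.

(** Without the forcing term c, exp(- nu) w is nonincreasing up to a quadratic error:
    as w >= 0, the factor 1 + d is absorbed by exp d.  The forcing contributes at
    most a multiple of the increment of exp(kap t), so subtracting a multiple of
    exp(kap t) leaves a function to which [quadratic_nonincreasing] applies. *)
Lemma gronwall_quad {R : realType} (w nu : R -> R) (a b K kap c C : R) :
  a <= b -> 0 < kap -> 0 <= c -> 0 <= C ->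
  (forall t, a <= t -> t <= b -> 0 <= w t) ->
  (forall t, a <= t -> t <= b -> nu b - nu t <= K - kap * (b - t)) ->
  (forall s t, a <= s -> s <= t -> t <= b ->
     w t <= w s * (1 + (nu t - nu s)) + c * (t - s) + C * (t - s) ^+ 2) ->
  w b <= expR (nu b - nu a) * w a + expR K * (c / kap).
Proof.
move=> ab kap0 c0 C0 w0 nuK wle.
pose v t := expR (- nu t) * w t.
(* exp(- nu t) <= E exp(kap t) on [a, b], by the bound on nu. *)
pose E := expR (K - kap * b - nu b).
pose Q t := c / kap * expR (kap * t).
have E0 : 0 < E by exact: expR_gt0.
have nuE t : a <= t -> t <= b -> expR (- nu t) <= E * expR (kap * t).
  move=> at_ tb; rewrite /E -expRD ler_expR.
  by have := nuK t at_ tb; lra.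
have vstep s t : a <= s -> s <= t -> t <= b ->
    v t - v s <= E * expR (kap * t) * (c * (t - s) + C * (t - s) ^+ 2).
  move=> as_ st tb.
  have /(ler_wpM2l (expR_ge0 (- nu t))) := wle s t as_ st tb.
  rewrite -addrA mulrDr => h1.
  have h2 : expR (- nu t) * (w s * (1 + (nu t - nu s))) <= v s.
    rewrite /v mulrCA mulrC ler_wpM2r ?w0 //; first exact: le_trans st tb.
    have <- : expR (- nu t) * expR (nu t - nu s) = expR (- nu s).
      by rewrite -expRD; congr expR; ring.
    by rewrite ler_wpM2l ?expR_ge0 // expR_ge1Dx.
  have h3 : expR (- nu t) * (c * (t - s) + C * (t - s) ^+ 2) <=
      E * expR (kap * t) * (c * (t - s) + C * (t - s) ^+ 2).
    apply: ler_wpM2r; last by apply: nuE => //; exact: le_trans as_ st.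
    by rewrite addr_ge0 // mulr_ge0 ?sqr_ge0 ?subr_ge0.
  rewrite {1}/v; lra.
have Qstep s t : s <= t ->
    expR (kap * t) * (c * (t - s) - c * kap * (t - s) ^+ 2) <= Q t - Q s.
  move=> st.
  have u0 : 0 <= kap * (t - s) by rewrite mulr_ge0 ?subr_ge0 // ltW.
  have := expRN_le_quad _ u0 => hu.
  have -> : Q t - Q s = expR (kap * t) * (c / kap * (1 - expR (- (kap * (t - s))))).
    rewrite /Q mulrBr mulr1 mulrBr [_ * (c / kap)]mulrC; congr (_ - _).
    by rewrite mulrCA -expRD; congr (_ * expR _); ring.
  apply: ler_wpM2l; first exact: expR_ge0.
  have -> : c * (t - s) - c * kap * (t - s) ^+ 2 =
      c / kap * (1 - (1 - kap * (t - s) + (kap * (t - s)) ^+ 2)).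
    by field; rewrite gt_eqF.
  apply: ler_wpM2l; first by rewrite divr_ge0 // ltW.
  by rewrite lerB.
have Hle : v b - E * Q b <= v a - E * Q a.
  apply: (@quadratic_nonincreasing _ (fun t => v t - E * Q t) a b
    (E * expR (kap * b) * (C + c * kap))) => // s t as_ st tb.
  have h1 := vstep s t as_ st tb.
  have /(ler_wpM2l (ltW E0)) h2 := Qstep s t st.
  have h3 : E * expR (kap * t) * (C + c * kap) * (t - s) ^+ 2 <=
      E * expR (kap * b) * (C + c * kap) * (t - s) ^+ 2.
    rewrite ler_wpM2r ?sqr_ge0 // ler_wpM2r ?addr_ge0 ?mulr_ge0 // ?(ltW kap0) //.
    by rewrite ler_wpM2l ?(ltW E0) // ler_expR ler_wpM2l // ltW.
  lra.
have Qa0 : 0 <= E * Q a.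
  by rewrite mulr_ge0 ?(ltW E0) // mulr_ge0 ?expR_ge0 // divr_ge0 // ltW.
have : v b <= v a + E * Q b by lra.
move=> /(ler_wpM2l (expR_ge0 (nu b))).
have -> : expR (nu b) * v b = w b.
  by rewrite /v mulrA -expRD subrr expR0 mul1r.
have -> : expR (nu b) * (v a + E * Q b) =
    expR (nu b) * expR (- nu a) * w a +
    expR (nu b) * E * expR (kap * b) * (c / kap).
  by rewrite /v /Q; ring.
rewrite /E -!expRD.
by have -> : nu b + (K - kap * b - nu b) + kap * b = K by ring.
Qed.

Lemma expR_taylor1 {R : realType} (B : R) : 0 <= B ->
  exists2 C : R, 0 <= C &
  forall u, `|u| <= B -> `|expR u - 1 - u| <= C * u ^+ 2.
Proof.
move=> B0.
(* For |u| <= 1/2 the constant 2 is enough; beyond, u^2 >= 1/4, whence the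
   factor 4 on the crude bound exp B + B. *)
exists (4 * (expR B + B)).
  by rewrite mulr_ge0 // addr_ge0 // expR_ge0.
move=> u uB.
have e1 := expR_ge1Dx u.
rewrite ger0_norm; last by lra.
have eB1 : 1 <= expR B by have := expR_ge1Dx B; lra.
have [hu|hu] := lerP `|u| (1/2).
  have /ler_normlP[h1 h2] := hu.
  have e2 := expR_ge1Dx (- u).
  rewrite expRN in e2.
  have : (1 - u) * expR u <= 1 by rewrite -ler_pdivlMr ?expR_gt0 // mul1r.
  move=> e3.
  have e4 : (1 - u) * (expR u - 1 - u) <= u ^+ 2 by nra.
  have q0 : 0 <= expR u - 1 - u by lra.
  have : (1 / 2) * (expR u - 1 - u) <= (1 - u) * (expR u - 1 - u).
    by apply: ler_wpM2r => //; lra.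
  have : u ^+ 2 * 1 <= u ^+ 2 * (expR B + B) by apply: ler_wpM2l;
    rewrite ?sqr_ge0 //; lra.
  lra.
have h4 : 1 / 4 <= u ^+ 2.
  rewrite -(real_normK (num_real u)) (_ : 1/4 = (1/2)^+2); last by field.
  by rewrite ler_pXn2r ?nnegrE //; lra.
have /ler_normlP[h1 h2] := uB.
have : expR u <= expR B by rewrite ler_expR.
have : (expR B + B) * (1/4) <= (expR B + B) * u ^+ 2.
  by apply: ler_wpM2l => //; lra.
lra.
Qed.

(** * Linear systems up to quadratic errors *)

Lemma mx_entry_norm_le {R : realType} {m n : nat} (A : 'M[R]_(m, n)) i j :
  `|A i j| <= `|A|.
Proof.
by rewrite [leRHS]/Num.norm/= mx_normrE; exact: (le_bigmax _ _ (i, j)).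
Qed.

Lemma mx_norm_le {R : realType} {m n : nat} (A : 'M[R]_(m, n)) (c : R) :
  0 <= c -> (forall i j, `|A i j| <= c) -> `|A| <= c.
Proof.
by move=> c0 Ac; rewrite [leLHS]/Num.norm/= mx_normrE (bigmax_le _ c0).
Qed.

Lemma mulmx_norm_le {R : realType} {m n p : nat} (A : 'M[R]_(m, n)) (Z :
  'M[R]_(n, p)) :
  `|A *m Z| <= n%:R * `|A| * `|Z|.
Proof.
apply: mx_norm_le => [|i j]; first by rewrite !mulr_ge0.
rewrite mxE; apply: le_trans (ler_norm_sum _ _ _) _.
apply: (@le_trans _ _ (\sum_(k < n) `|A| * `|Z|)).
  by apply: ler_sum => k _; rewrite normrM ler_pM // mx_entry_norm_le.
by rewrite sumr_const card_ord -[leLHS]mulr_natl mulrA.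
Qed.

(** For B(s, t) the integral of A over [s, t] this says that Z solves Z' = A Z in the
    sense of Caratheodory, without any integral of A Z.  The initial time a is a
    parameter because entries of a solution may vanish from a time on only. *)
Definition quad_solution {R : realType} {n m : nat} (a : R)
    (B : R -> R -> 'M[R]_n) (Z : R -> 'M[R]_(n, m)) : Prop :=
  forall T, exists2 C : R, 0 <= C & forall s t, a <= s -> s <= t -> t <= T ->
    `|Z t - Z s - B s t *m Z s| <= C * (t - s) ^+ 2.

Lemma eq_quad_solution {R : realType} {n m : nat} (a : R)
    (B B' : R -> R -> 'M[R]_n) (Z : R -> 'M[R]_(n, m)) :
  (forall s t, a <= s -> s <= t -> B s t = B' s t) ->
  quad_solution a B Z -> quad_solution a B' Z.
Proof.
move=> BB' ZB T; have [C C0 ZC] := ZB T; exists C => // s t as_ st tT.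
by rewrite -BB' // ZC.
Qed.

Definition lipschitz_flow {R : realType} {n : nat} (L : R)
    (B : R -> R -> 'M[R]_n) : Prop :=
  forall s t, 0 <= s -> s <= t -> `|B s t| <= L * (t - s).

(** |Z| satisfies the hypothesis of [gronwall_quad] with nu(t) = n L t and no forcing. *)
Lemma quad_solution_growth {R : realType} {n m : nat} (a L : R)
    (B : R -> R -> 'M[R]_n) (Z : R -> 'M[R]_(n, m)) :
  0 <= a -> 0 <= L -> lipschitz_flow L B -> quad_solution a B Z ->
  forall s t, a <= s -> s <= t -> `|Z t| <= expR (n%:R * L * (t - s)) * `|Z s|.
Proof.
move=> a0 L0 BL ZB s t as_ st.
have [C C0 ZC] := ZB t.
have := @gronwall_quad _ (fun t => `|Z t|) (fun t => n%:R * L * t) s t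
  ((n%:R * L + 1) * (t - s)) 1 0 C st ltr01 (lexx 0) C0.
rewrite mul0r mulr0 addr0 -mulrBr; apply => //.
  move=> r sr rt; have : n%:R * L * r >= n%:R * L * s by rewrite ler_wpM2l //
    mulr_ge0.
  by lra.
move=> p q sp pq qt; rewrite -mulrBr mul0r addr0.
have ap := le_trans as_ sp.
have h1 := ZC p q ap pq qt.
have h2 : `|B p q *m Z p| <= n%:R * (L * (q - p)) * `|Z p|.
  apply: le_trans (mulmx_norm_le _ _) _; apply: ler_wpM2r => //.
  by apply: ler_wpM2l => //; apply: BL => //; exact: le_trans ap.
have -> : Z q = (Z q - Z p - B p q *m Z p) + (Z p + B p q *m Z p).
  by rewrite [Z p + _]addrC addrA !subrK.
apply: le_trans (ler_normD _ _) _.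
apply: (@le_trans _ _ (C * (q - p) ^+ 2 + (`|Z p| + n%:R * (L * (q - p)) * `|Z p|))).
  by rewrite lerD // (le_trans (ler_normD _ _)) // lerD2l.
by rewrite le_eqVlt; apply/orP; left; apply/eqP; ring.
Qed.

Lemma quad_solutionB {R : realType} {n m : nat} (a : R)
    (B : R -> R -> 'M[R]_n) (Y Z : R -> 'M[R]_(n, m)) :
  quad_solution a B Y -> quad_solution a B Z ->
  quad_solution a B (fun t => Y t - Z t).
Proof.
move=> YB ZB T; have [C C0 YC] := YB T; have [D D0 ZD] := ZB T.
exists (C + D) => [|s t as_ st tT]; first exact: addr_ge0.
have -> : Y t - Z t - (Y s - Z s) - B s t *m (Y s - Z s) =
    (Y t - Y s - B s t *m Y s) - (Z t - Z s - B s t *m Z s).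
  by rewrite mulmxBr; apply/matrixP => i j; rewrite !mxE; ring.
by rewrite mulrDl (le_trans (ler_normB _ _)) // lerD // ?YC ?ZD.
Qed.

Lemma quad_solutionMr {R : realType} {n m p : nat} (a : R)
    (B : R -> R -> 'M[R]_n) (Z : R -> 'M[R]_(n, m)) (W : 'M[R]_(m, p)) :
  quad_solution a B Z -> quad_solution a B (fun t => Z t *m W).
Proof.
move=> ZB T; have [C C0 ZC] := ZB T.
exists (m%:R * C * `|W|) => [|s t as_ st tT]; first by rewrite !mulr_ge0.
rewrite mulmxA -!mulmxBl (le_trans (mulmx_norm_le _ _)) //.
by rewrite [leRHS]mulrAC ler_wpM2r // -mulrA ler_wpM2l // ZC.
Qed.

Lemma quad_solution_unique {R : realType} {n m : nat} (a L : R)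
    (B : R -> R -> 'M[R]_n) (Y Z : R -> 'M[R]_(n, m)) :
  0 <= a -> 0 <= L -> lipschitz_flow L B ->
  quad_solution a B Y -> quad_solution a B Z -> Y a = Z a ->
  forall t, a <= t -> Y t = Z t.
Proof.
move=> a0 L0 BL YB ZB YZ t at_.
have := quad_solution_growth _ _ _ _ a0 L0 BL (quad_solutionB _ _ _ _ YB ZB) a t (lexx a) at_.
by rewrite YZ subrr normr0 mulr0 normr_le0 subr_eq0 => /eqP.
Qed.

(** Product rule for exp(nu) Z: the increment of exp(nu) is exp(nu(s)) (nu(t) - nu(s))
    up to a quadratic error, as nu is Lipschitz.  Linear nu shifts the spectrum;
    nu the integral of a diagonal entry, applied to a constant Z, solves the scalar
    equation. *)
Lemma quad_solution_expR {R : realType} {n m : nat} (a L Lnu : R)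
    (B : R -> R -> 'M[R]_n) (Z : R -> 'M[R]_(n, m)) (nu : R -> R) :
  0 <= a -> 0 <= L -> 0 <= Lnu -> lipschitz_flow L B ->
  (forall s t, a <= s -> s <= t -> `|nu t - nu s| <= Lnu * (t - s)) ->
  quad_solution a B Z ->
  quad_solution a (fun s t => B s t + (nu t - nu s)%:M)
    (fun t => expR (nu t) *: Z t).
Proof.
move=> a0 L0 Lnu0 BL nuL ZB T.
have [Ta|aT] := ltP T a.
  by exists 0 => // s t as_ st tT; have := le_trans (le_trans as_ st) tT;
    rewrite leNgt Ta.
have [C0 C00 ZC] := ZB T.
have [D D0 eD] := @expR_taylor1 R (Lnu * (T - a)) ltac:(by rewrite mulr_ge0 //
  subr_ge0).
pose E := expR (nu a + Lnu * (T - a)).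
pose ZT := expR (n%:R * L * (T - a)) * `|Z a|.
have E0 : 0 <= E by exact: expR_ge0.
have ZT0 : 0 <= ZT by rewrite mulr_ge0 // expR_ge0.
pose D1 := Lnu + D * Lnu ^+ 2 * (T - a).
have D10 : 0 <= D1 by rewrite addr_ge0 // !mulr_ge0 ?sqr_ge0 ?subr_ge0.
exists (E * C0 + E * (D * Lnu ^+ 2) * ZT + E * D1 * (n%:R * L * ZT)).
  by rewrite !addr_ge0 // !mulr_ge0 ?sqr_ge0.
move=> s t as_ st tT.
have sT := le_trans st tT.
have at_ := le_trans as_ st.
have nuE r : a <= r -> r <= T -> expR (nu r) <= E.
  move=> ar rT; rewrite ler_expR -lerBlDl.
  apply: le_trans (ler_norm _) _; apply: le_trans (nuL _ _ (lexx a) ar) _.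
  by rewrite ler_wpM2l // lerD2r.
have ZE : `|Z s| <= ZT.
  apply: le_trans (quad_solution_growth _ _ _ _ a0 L0 BL ZB a s (lexx _) as_) _.
  by rewrite ler_wpM2r // ler_expR ler_wpM2l ?mulr_ge0 // lerD2r.
set d := nu t - nu s; set tau := t - s.
have tau0 : 0 <= tau by rewrite subr_ge0.
have tauT : tau <= T - a by rewrite /tau; lra.
have dL : `|d| <= Lnu * tau by exact: nuL.
have dT : `|d| <= Lnu * (T - a) by apply: le_trans dL _; rewrite ler_wpM2l.
have ed := eD d dT.
have d2 : d ^+ 2 <= Lnu ^+ 2 * tau ^+ 2.
  by rewrite -exprMn -(real_normK (num_real d)) ler_pXn2r // nnegrE mulr_ge0.
have ed2 : `|expR d - 1 - d| <= D * Lnu ^+ 2 * tau ^+ 2.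
  by apply: le_trans ed _; rewrite -mulrA ler_wpM2l.
have ed1 : `|expR d - 1| <= D1 * tau.
  have -> : expR d - 1 = (expR d - 1 - d) + d by ring.
  apply: le_trans (ler_normD _ _) _.
  have : D * Lnu ^+ 2 * tau * tau <= D * Lnu ^+ 2 * (T - a) * tau.
    by rewrite ler_wpM2r // ler_wpM2l // mulr_ge0 // sqr_ge0.
  by rewrite /D1; lra.
have et : expR (nu t) = expR (nu s) * expR d by rewrite -expRD /d; congr expR;
  ring.
have -> : expR (nu t) *: Z t - expR (nu s) *: Z s -
    (B s t + d%:M) *m (expR (nu s) *: Z s) =
    expR (nu t) *: (Z t - Z s - B s t *m Z s) +
    (expR (nu s) * (expR d - 1 - d)) *: Z s +
    (expR (nu s) * (expR d - 1)) *: (B s t *m Z s).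
  rewrite mulmxDl -!scalemxAr mul_scalar_mx et.
  by apply/matrixP => i j; rewrite !mxE; ring.
have h1 := ZC s t as_ st tT.
have es := nuE s as_ sT.
have h2 : `|B s t *m Z s| <= n%:R * (L * tau) * ZT.
  apply: le_trans (mulmx_norm_le _ _) _; rewrite ler_pM // ?mulr_ge0 //.
  by rewrite ler_wpM2l // BL // (le_trans a0).
rewrite 2!mulrDl; apply: le_trans (ler_normD _ _) _; apply: lerD.
  apply: le_trans (ler_normD _ _) _; apply: lerD.
    rewrite normrZ ger0_norm ?expR_ge0 // -mulrA ler_pM ?expR_ge0 //.
    exact: nuE.
  rewrite normrZ normrM (ger0_norm (expR_ge0 _)) [leRHS]mulrAC.
  by rewrite ler_pM ?mulr_ge0 ?expR_ge0 // -mulrA ler_pM ?expR_ge0.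
rewrite normrZ normrM (ger0_norm (expR_ge0 _)).
apply: (@le_trans _ _ (E * (D1 * tau) * (n%:R * (L * tau) * ZT))).
  by rewrite ler_pM ?mulr_ge0 ?expR_ge0 // ler_pM ?expR_ge0.
by rewrite le_eqVlt; apply/orP; left; apply/eqP; ring.
Qed.

(** * Dichotomies for all shifts and uniform stability *)

(** The shift enters through the flow, so that systems with different shifts are
    compared with the solutions of the single flow B. *)
Definition quad_dichotomy {R : realType} {n : nat} (B : R -> R -> 'M[R]_n)
    (gamma : R) (Phi : R -> 'M[R]_n) (P : 'M[R]_n) (K alpha : R) : Prop :=
  [/\ quad_solution 0 (fun s t => B s t - (gamma * (t - s))%:M) Phi,
      forall t, 0 <= t -> Phi t \in unitmx,
      P *m P = P /\ 1 <= K /\ 0 < alpha,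
      forall s t, 0 <= s -> s <= t ->
        `|Phi t *m P *m invmx (Phi s)| <= K * expR (- alpha * (t - s)) &
      forall s t, 0 <= t -> t <= s ->
        `|Phi t *m (1%:M - P) *m invmx (Phi s)| <= K * expR (- alpha * (s - t))].

Lemma norm_scalar_mx_le {R : realType} {n : nat} (c : R) : `|c%:M :
  'M[R]_n| <= `|c|.
Proof. by apply: mx_norm_le => // i j; rewrite mxE; case: eqP;
  rewrite ?mulr1n ?mulr0n ?normr0. Qed.

Lemma lipschitz_flow_shift {R : realType} {n : nat} (L gamma : R)
    (B : R -> R -> 'M[R]_n) : lipschitz_flow L B ->
  lipschitz_flow (L + `|gamma|) (fun s t => B s t - (gamma * (t - s))%:M).
Proof.
move=> BL s t s0 st; rewrite mulrDl (le_trans (ler_normB _ _)) // lerD ?BL //.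
by rewrite (le_trans (norm_scalar_mx_le _)) // normrM (ger0_norm (x :=
  t - s)) ?subr_ge0.
Qed.

Lemma quad_solution_shift {R : realType} {n m : nat} (L gamma : R)
    (B : R -> R -> 'M[R]_n) (Z : R -> 'M[R]_(n, m)) :
  0 <= L -> lipschitz_flow L B -> quad_solution 0 B Z ->
  quad_solution 0 (fun s t => B s t - (gamma * (t - s))%:M)
    (fun t => expR (- gamma * t) *: Z t).
Proof.
move=> L0 BL ZB.
have := @quad_solution_expR _ _ _ 0 L `|gamma| B Z (fun t => - gamma * t)
  (lexx 0) L0 (normr_ge0 _) BL.
have nuL s t : 0 <= s -> s <= t ->
  `|- gamma * t - - gamma * s| <= `|gamma| * (t - s).
  by move=> _ st; rewrite -mulrBr normrM normrN (ger0_norm (x :=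
    t - s)) ?subr_ge0.
move=> /(_ nuL ZB); apply: eq_quad_solution => s t _ _; congr (_ + _).
by rewrite -raddfN; congr (_%:M); ring.
Qed.

Lemma quad_solution_unshift {R : realType} {n m : nat} (L gamma : R)
    (B : R -> R -> 'M[R]_n) (Z : R -> 'M[R]_(n, m)) :
  0 <= L -> lipschitz_flow L B ->
  quad_solution 0 (fun s t => B s t - (gamma * (t - s))%:M) Z ->
  quad_solution 0 B (fun t => expR (gamma * t) *: Z t).
Proof.
move=> L0 BL ZB.
have := @quad_solution_shift _ _ _ _ (- gamma) _ _
  (addr_ge0 L0 (normr_ge0 gamma)) (lipschitz_flow_shift _ gamma _ BL) ZB.
rewrite opprK; apply: eq_quad_solution => s t _ _.
rewrite -addrA -opprD -raddfD /=.
by rewrite mulNr subrr raddf0 subr0.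
Qed.

(** By uniqueness exp(- gamma t) Z(t) = Phi(t) Phi(0)^-1 Z(0), and the dichotomy
    bounds the right-hand side by a multiple of exp(- alpha t). *)
Lemma dichotomy_proj1_decay {R : realType} {n : nat} (L gamma K alpha : R)
    (B : R -> R -> 'M[R]_n) (Phi Z : R -> 'M[R]_n) :
  0 <= L -> lipschitz_flow L B -> quad_dichotomy B gamma Phi 1%:M K alpha ->
  quad_solution 0 B Z ->
  exists C, forall t, 0 <= t -> `|Z t| <= C * expR ((gamma - alpha) * t).
Proof.
move=> L0 BL [PhiB Phiu [_ [K1 a0]] fwd _] ZB.
exists (n%:R * K * `|Z 0|) => t t0.
have Zeq : expR (- gamma * t) *: Z t = Phi t *m (invmx (Phi 0) *m Z 0).
  have L'0 : 0 <= L + `|gamma| by rewrite addr_ge0.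
  have BL' := lipschitz_flow_shift _ gamma _ BL.
  have ZB' := quad_solution_shift _ gamma _ _ L0 BL ZB.
  have := quad_solution_unique _ _ _ _ _ (lexx 0) L'0 BL' ZB'
    (quad_solutionMr _ _ _ (invmx (Phi 0) *m Z 0) PhiB) _ t t0.
  by apply; rewrite mulr0 expR0 scale1r mulmxA mulmxV ?mul1mx // Phiu.
have -> : Z t = expR (gamma * t) *: (Phi t *m 1%:M *m invmx (Phi 0) *m Z 0).
  rewrite mulmx1 -mulmxA -Zeq scalerA -expRD.
  by have -> : gamma * t + - gamma * t = 0; [ring | rewrite expR0 scale1r].
rewrite normrZ ger0_norm ?expR_ge0 //.
apply: (@le_trans _ _ (expR (gamma * t) * (n%:R * (K * expR (- alpha * (t - 0))) * `|Z 0|))).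
  rewrite ler_wpM2l ?expR_ge0 // (le_trans (mulmx_norm_le _ _)) //.
  by rewrite ler_wpM2r // ler_wpM2l // fwd.
have -> : (gamma - alpha) * t = gamma * t + - alpha * (t - 0) by ring.
by rewrite expRD le_eqVlt; apply/orP; left; apply/eqP; ring.
Qed.

(** The solution starting in the range of 1 - P, transported back from t to 0 by the
    backward estimate, shrinks at least like exp(- alpha t). *)
Lemma dichotomy_growing_solution {R : realType} {n : nat} (L gamma K alpha : R)
    (B : R -> R -> 'M[R]_n) (Phi : R -> 'M[R]_n) (P : 'M[R]_n) :
  0 <= L -> lipschitz_flow L B -> quad_dichotomy B gamma Phi P K alpha ->
  P <> 1%:M ->
  exists Z : R -> 'M[R]_n, exists2 c, 0 < c & quad_solution 0 B Z /\
  forall t, 0 <= t -> c * expR ((gamma + alpha) * t) <= `|Z t|.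
Proof.
move=> L0 BL [PhiB Phiu [PP [K1 a0]] _ bwd] P1.
exists (fun t => expR (gamma * t) *: (Phi t *m (1%:M - P))).
have QQ : (1%:M - P) *m (1%:M - P) = 1%:M - P.
  by rewrite mulmxBl mul1mx mulmxBr mulmx1 PP subrr subr0.
have c0 : 0 < `|Phi 0 *m (1%:M - P)|.
  rewrite normr_gt0; apply/eqP => h; apply: P1.
  have /(congr1 (fun X => invmx (Phi 0) *m X)) := h.
  by rewrite mulmxA mulVmx ?Phiu // mul1mx mulmx0 => /eqP;
    rewrite subr_eq0 => /eqP.
have n0 : 0 < n%:R :> R.
  rewrite ltr0n lt0n; apply/eqP => n0; move: c0.
  rewrite normr_gt0 => /eqP; apply; apply/matrixP => i.
  by have := ltn_ord i; rewrite [X in (_ < X)%N]n0.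
have K0 : 0 < K by lra.
have nK : 0 < n%:R * K by rewrite mulr_gt0.
exists (`|Phi 0 *m (1%:M - P)| / (n%:R * K)); first by rewrite divr_gt0.
split.
  apply: (quad_solution_unshift _ _ _ _ L0 BL).
  exact: quad_solutionMr.
move=> t t0.
have h : `|Phi 0 *m (1%:M - P)| <=
    n%:R * (K * expR (- alpha * (t - 0))) * `|Phi t *m (1%:M - P)|.
  have -> : Phi 0 *m (1%:M - P) =
      Phi 0 *m (1%:M - P) *m invmx (Phi t) *m (Phi t *m (1%:M - P)).
    by rewrite !mulmxA mulmxKV ?Phiu // -mulmxA QQ.
  rewrite (le_trans (mulmx_norm_le _ _)) //.
  by rewrite ler_wpM2r // ler_wpM2l // bwd.
rewrite normrZ ger0_norm ?expR_ge0 // mulrDl expRD mulrCA ler_wpM2l ?expR_ge0 //.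
rewrite mulrAC ler_pdivrMr //.
apply: le_trans (ler_wpM2r (expR_ge0 (alpha * t)) h) _.
rewrite le_eqVlt; apply/orP; left; apply/eqP.
have e1 : expR (- alpha * (t - 0)) * expR (alpha * t) = 1.
  by rewrite -expRD -[RHS]expR0; congr expR; ring.
transitivity (n%:R * K * `|Phi t *m (1%:M - P)| *
  (expR (- alpha * (t - 0)) * expR (alpha * t))); first by ring.
by rewrite e1; ring.
Qed.

(** Let N be the set of the gamma >= 0 for which exp(- gamma t) Z(t) is unbounded for
    some solution Z; it is bounded above by the growth estimate.  A dichotomy at
    sup N contradicts the definition of the supremum: its projection cannot be the
    identity by [dichotomy_proj1_decay], and cannot differ from it by
    [dichotomy_growing_solution].  Hence N is empty, and a projection different
    from the identity at gamma = 0 would put an element into N. *)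
Lemma uniformly_stable_of_dichotomies {R : realType} {n : nat} (L : R)
    (B : R -> R -> 'M[R]_n) :
  0 <= L -> lipschitz_flow L B ->
  (forall gamma, 0 <= gamma ->
     exists Phi P K alpha, quad_dichotomy B gamma Phi P K alpha) ->
  exists Phi K alpha, quad_dichotomy B 0 Phi 1%:M K alpha.
Proof.
move=> L0 BL ED.
(* Solutions are taken to be matrices: the growing one is Phi (1 - P). *)
pose N := [set gamma : R | 0 <= gamma /\ exists2 Z : R -> 'M[R]_n,
  quad_solution 0 B Z &
  forall M, exists2 t, 0 <= t & M < expR (- gamma * t) * `|Z t|].
have grow gamma Phi P K alpha : 0 <= gamma ->
    quad_dichotomy B gamma Phi P K alpha -> P <> 1%:M -> N (gamma + alpha / 2).
  move=> g0 edg P1; have [_ _ [_ [_ a0]] _ _] := edg.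
  have [Z [c c0 [ZB Zc]]] := dichotomy_growing_solution _ _ _ _ _ _ _ L0 BL edg P1.
  split; first by rewrite addr_ge0 // divr_ge0 // ltW.
  exists Z => // M.
  (* There c (1 + alpha t / 2) = c + |M|. *)
  exists (2 * `|M| / (c * alpha)).
    by rewrite divr_ge0 ?mulr_ge0 // ltW.
  set t := 2 * `|M| / _.
  have t0 : 0 <= t by rewrite /t divr_ge0 ?mulr_ge0 // ltW.
  have /(ler_wpM2l (expR_ge0 (- (gamma + alpha / 2) * t))) := Zc t t0 => hz.
  apply: lt_le_trans _ hz.
  have -> : expR (- (gamma + alpha / 2) * t) * (c * expR ((gamma + alpha) * t)) =
      c * expR (alpha / 2 * t).
    by rewrite mulrCA -expRD; congr (_ * expR _); field.
  apply: (@lt_le_trans _ _ (c * (1 + alpha / 2 * t))); last first.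
    by rewrite ler_wpM2l ?(ltW c0) // expR_ge1Dx.
  have -> : c * (1 + alpha / 2 * t) = c + `|M|.
    by rewrite /t; field; rewrite !gt_eqF.
  by have := ler_norm M; lra.
have N0 : N = set0.
  apply/seteqP; split=> // g1 Ng1.
  have Nub : has_sup N.
    split; first by exists g1.
    exists (n%:R * L) => g [g0 [Z ZB Zinf]].
    rewrite leNgt; apply/negP => gL.
    have [t t0] := Zinf `|Z 0|; apply/negP; rewrite -leNgt.
    have := quad_solution_growth _ _ _ _ (lexx 0) L0 BL ZB 0 t (lexx 0) t0.
    move=> /(ler_wpM2l (expR_ge0 (- g * t)))/le_trans; apply.
    rewrite mulrA -expRD -[leRHS]mul1r ler_wpM2r // -[leRHS]expR0 ler_expR subr0.
    by have : n%:R * L * t <= g * t; [rewrite ler_wpM2r // ltW | lra].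
  have g1s : g1 <= sup N by apply: ub_le_sup => //; case: Nub.
  have s0 : 0 <= sup N by apply: le_trans g1s; case: Ng1.
  have [Phi [P [K [alpha edg]]]] := ED _ s0.
  have [_ _ [_ [_ a0]] _ _] := edg.
  have [P1|P1] := pselect (P = 1%:M); last first.
    have := grow _ _ _ _ _ s0 edg P1 => /(ub_le_sup (proj2 Nub)); lra.
  rewrite P1 in edg.
  have [g Ng gs] := sup_adherent a0 Nub.
  case: Ng => g0 [Z ZB Zinf].
  have [C ZC] := dichotomy_proj1_decay _ _ _ _ _ _ _ L0 BL edg ZB.
  have [t t0] := Zinf `|C|; apply/negP; rewrite -leNgt.
  have /(ler_wpM2l (expR_ge0 (- g * t)))/le_trans := ZC t t0; apply.
  rewrite mulrCA -expRD.
  apply: (@le_trans _ _ (`|C| * expR (- g * t + (sup N - alpha) * t))).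
    by rewrite ler_wpM2r ?expR_ge0 // ler_norm.
  rewrite -[leRHS]mulr1 ler_wpM2l // -[leRHS]expR0 ler_expR -mulrDl.
  by rewrite mulr_le0_ge0 //; lra.
have [Phi [P [K [alpha edg]]]] := ED _ (lexx 0).
have [P1|P1] := pselect (P = 1%:M).
  by exists Phi, K, alpha; rewrite -P1.
by have := grow _ _ _ _ _ (lexx 0) edg P1; rewrite N0.
Qed.

(** In column i the entries below the diagonal solve, from the last one upwards,
    homogeneous scalar equations with initial value 0, so they vanish; then the
    diagonal entry solves a homogeneous scalar equation with initial value 1. *)
Lemma triangular_solution_diag {R : realType} {n : nat} (L : R)
    (B : R -> R -> 'M[R]_n) (mu : R -> R) (U : R -> 'M[R]_n) (i : 'I_n) (a : R) :
  0 <= a -> 0 <= L -> lipschitz_flow L B ->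
  (forall s t, a <= s -> s <= t -> forall j k : 'I_n, (k < j)%N ->
    B s t j k = 0) ->
  (forall s t, a <= s -> s <= t -> B s t i i = mu t - mu s) ->
  quad_solution a B U -> U a = 1%:M ->
  forall t, a <= t -> U t i i = expR (mu t - mu a).
Proof.
move=> a0 L0 BL Btri Bmu UB Ua.
pose b (j : 'I_n) s t : 'M[R]_1 := (B s t j j)%:M.
have bL j : lipschitz_flow L (b j).
  move=> s t s0 st; apply: le_trans (norm_scalar_mx_le _) _.
  by apply: le_trans (mx_entry_norm_le _ _ _) _; exact: BL.
(* Once the lower entries of column i vanish, entry j solves a scalar equation. *)
have entry (j : 'I_n) :
    (forall k : 'I_n, (j < k)%N -> forall t, a <= t -> U t k i = 0) ->
    quad_solution a (b j) (fun t => (U t j i)%:M : 'M[R]_1).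
  move=> below T; have [C C0 UC] := UB T; exists C => // s t as_ st tT.
  apply: mx_norm_le => [|p q]; first by rewrite mulr_ge0 // sqr_ge0.
  apply: le_trans _ (UC s t as_ st tT).
  apply: le_trans _ (mx_entry_norm_le _ j i).
  rewrite /b -scalar_mxM !mxE (ord1 p) (ord1 q) !eqxx !mulr1n.
  rewrite (bigD1 j) //= big1 ?addr0 // => k kj.
  case: (ltngtP k j) => [kj'|jk|/val_inj kjE].
  - by rewrite Btri // mul0r.
  - by rewrite below // mulr0.
  - by rewrite kjE eqxx in kj.
have below (m : nat) : forall j : 'I_n, (i < j)%N -> (n - j <= m)%N ->
    forall t, a <= t -> U t j i = 0.
  elim: m => [|m IH] j ij jm t at_.
    by have := ltn_ord j; rewrite -subn_gt0 ltnNge jm.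
  have jB : quad_solution a (b j) (fun t => (U t j i)%:M : 'M[R]_1).
    apply: entry => k jk r ar; apply: IH => //; first exact: ltn_trans jk.
    by rewrite -ltnS (leq_trans _ jm) // ltn_sub2l.
  have zB : quad_solution a (b j) (fun=> 0 : 'M[R]_1).
    by move=> T; exists 0 => // *; rewrite mulmx0 !subr0 normr0 mul0r.
  have := quad_solution_unique _ _ _ _ _ a0 L0 (bL j) jB zB _ t at_.
  rewrite Ua mxE -val_eqE gtn_eqF // mulr0n raddf0 => /(_ erefl).
  by move/matrixP/(_ ord0 ord0); rewrite !mxE eqxx mulr1n.
have iB := entry i (fun k ik t at_ => below _ k ik (leqnn _) t at_).
have eB : quad_solution a (b i) (fun t => expR (mu t) *: ((expR (- mu a))%:M :
  'M[R]_1)).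
  have := @quad_solution_expR _ 1 1 a 0 L (fun _ _ => 0)
    (fun=> (expR (- mu a))%:M) mu a0 (lexx 0) L0.
  have z0 : lipschitz_flow 0 (fun _ _ : R => 0 : 'M[R]_1).
    by move=> s t _ _; rewrite normr0 mul0r.
  have zB : quad_solution a (fun _ _ : R => 0 :
    'M[R]_1) (fun=> (expR (- mu a))%:M : 'M[R]_1).
    by move=> T; exists 0 => // *; rewrite subrr mul0mx subr0 normr0 mul0r.
  move=> /(_ z0); have muL s t : a <= s -> s <= t ->
    `|mu t - mu s| <= L * (t - s).
    move=> as_ st; rewrite -Bmu //.
    by apply: le_trans (mx_entry_norm_le _ _ _) _; apply: BL => //;
      exact: le_trans as_.
  move=> /(_ muL zB) h T; have [C C0 hC] := h T; exists C => // s t as_ st tT.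
  by have := hC s t as_ st tT; rewrite add0r /b Bmu.
move=> t at_.
have := quad_solution_unique _ _ _ _ _ a0 L0 (bL i) iB eB _ t at_.
rewrite Ua mxE eqxx scale_scalar_mx -expRD subrr expR0 => /(_ erefl).
by move/matrixP/(_ ord0 ord0); rewrite !mxE eqxx !mulr1n -expRD.
Qed.

Lemma diag_exponent_le {R : realType} {n : nat} (L K alpha : R)
    (B : R -> R -> 'M[R]_n) (mu : R -> R) (Phi : R -> 'M[R]_n) (i : 'I_n) :
  0 <= L -> lipschitz_flow L B ->
  (forall s t, 0 <= s -> s <= t -> forall j k : 'I_n, (k < j)%N ->
    B s t j k = 0) ->
  (forall s t, 0 <= s -> s <= t -> B s t i i = mu t - mu s) ->
  quad_dichotomy B 0 Phi 1%:M K alpha ->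
  forall s t, 0 <= s -> s <= t -> mu t - mu s <= ln K - alpha * (t - s).
Proof.
move=> L0 BL Btri Bmu [PhiB Phiu [_ [K1 a0]] fwd _] s t s0 st.
have UB : quad_solution s B (fun t => Phi t *m invmx (Phi s)).
  apply: quad_solutionMr => T; have [C C0 PhiC] := PhiB T.
  exists C => // p q sp pq qT; have := PhiC p q (le_trans s0 sp) pq qT.
  by rewrite mul0r raddf0 subr0.
have /(_ _ st) Ut := triangular_solution_diag L B mu _ i s s0 L0 BL
  (fun p q sp => Btri p q (le_trans s0 sp)) (fun p q sp => Bmu p q (le_trans s0 sp))
  UB (mulmxV (Phiu s s0)).
have : expR (mu t - mu s) <= K * expR (- alpha * (t - s)).
  rewrite -Ut; apply: le_trans (ler_norm _) _.
  apply: le_trans (mx_entry_norm_le _ _ _) _.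
  by have := fwd s t s0 st; rewrite mulmx1.
have K0 : 0 < K by lra.
rewrite -{1}(@lnK _ K) ?posrE // -expRD ler_expR; lra.
Qed.

(** * Systems with bounded measurable coefficients *)

Lemma bounded_integrable {R : realType} (a b M : R) (f : R -> R) :
  measurable_fun `[a, b] f ->
  (forall u, a <= u -> u <= b -> `|f u| <= M) ->
  (@lebesgue_measure R).-integrable `[a, b] (EFin \o f).
Proof.
move=> mf fM; apply: measurable_bounded_integrable => //.
- rewrite /= lebesgue_measure_itv /=; case: ifP => // _.
  by rewrite -EFinD ltry.
- exists M; split; first exact: num_real.
  move=> N MN u /=; rewrite in_itv /= => /andP[au ub].
  by rewrite (le_trans (fM u au ub)) // ltW.
Qed.

Lemma Rintegral_cst_itv {R : realType} (a b c : R) : a <= b ->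
  \int[@lebesgue_measure R]_(u in `[a, b]) c = c * (b - a).
Proof.
move=> ab; rewrite Rintegral_cst //= lebesgue_measure_itv /= lte_fin.
case: ltP => //= ba.
by have -> : a = b; [apply/eqP; rewrite eq_le ab | rewrite subrr].
Qed.

Lemma norm_Rintegral_le {R : realType} (a b M : R) (f : R -> R) :
  a <= b -> measurable_fun `[a, b] f ->
  (forall u, a <= u -> u <= b -> `|f u| <= M) ->
  `|\int[@lebesgue_measure R]_(u in `[a, b]) f u| <= M * (b - a).
Proof.
move=> ab mf fM.
have intf := bounded_integrable _ _ _ _ mf fM.
apply: le_trans (le_normr_Rintegral _ _) _ => //.
rewrite -Rintegral_cst_itv //; apply: le_Rintegral => //.
- by apply: (@bounded_integrable _ _ _ M); [exact: measurableT_comp|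
    move=> u au ub; rewrite normr_id fM].
- by apply: (@bounded_integrable _ _ _ `|M|) => // *; exact: measurable_cst.
- by move=> u /=; rewrite in_itv /= => /andP[au ub]; exact: fM.
Qed.

Lemma Rintegral_itv_split {R : realType} (a s t : R) (f : R -> R) :
  a <= s -> s <= t ->
  (@lebesgue_measure R).-integrable `[a, t] (EFin \o f) ->
  \int[@lebesgue_measure R]_(u in `[s, t]) f u =
  \int[@lebesgue_measure R]_(u in `[a, t]) f u -
  \int[@lebesgue_measure R]_(u in `[a, s]) f u.
Proof.
move=> as_ st intf; rewrite Rintegral_itvB ?bnd_simp //.
rewrite Rintegral_itv_obnd_cbnd //; apply: integrableS intf => //.
by apply: subset_itvr; rewrite bnd_simp.
Qed.

Lemma within_itv_bounded {R : realType} {V : normedModType R} (f : R ->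
  V) (a b : R) :
  {within `[a, b], continuous f} ->
  exists2 Z : R, 0 <= Z & forall u : R, a <= u -> u <= b -> `|f u| <= Z.
Proof.
move=> cf.
have := compact_bounded (continuous_compact cf (@segment_compact _ a b)).
move=> [Z [Zr hZ]]; exists (`|Z| + 1); first by rewrite addr_ge0.
move=> u u0 uT; apply: hZ; first by rewrite (le_lt_trans (ler_norm Z)) // ltrDl.
by exists u => //=; rewrite in_itv /= u0.
Qed.

Definition int_flow {R : realType} {n : nat} (A : R -> 'M[R]_n) (s t : R) :
  'M[R]_n :=
  \matrix_(i, j) \int[@lebesgue_measure R]_(u in `[s, t]) A u i j.

Section bounded_system.
Context {R : realType} {n : nat} (A : R -> 'M[R]_n) (M : R).
Hypothesis Aint : loc_integrable_mx `[0, +oo[ A.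
Hypothesis AM : forall t : R, 0 <= t -> `|A t| <= M.

Lemma int_flow_measurable (s t : R) (i j : 'I_n) : 0 <= s -> s <= t ->
  measurable_fun `[s, t] (fun u => A u i j).
Proof.
move=> s0 st; have := Aint s t.
rewrite !in_itv /= s0 (le_trans s0 st) => /(_ isT isT i j).
by move=> /measurable_int /measurable_EFinP.
Qed.

Lemma int_flow_integrable (s t : R) (i j : 'I_n) : 0 <= s -> s <= t ->
  (@lebesgue_measure R).-integrable `[s, t] (EFin \o (fun u => A u i j)).
Proof.
by move=> s0 st; apply: Aint; rewrite in_itv /= ?s0 // (le_trans s0 st).
Qed.

Lemma int_flow_bound : 0 <= M.
Proof. exact: le_trans (normr_ge0 _) (AM _ (lexx 0)). Qed.

Lemma int_flow_lipschitz : lipschitz_flow M (int_flow A).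
Proof.
move=> s t s0 st; apply: mx_norm_le => [|i j].
  by rewrite mulr_ge0 ?int_flow_bound // subr_ge0.
rewrite mxE; apply: norm_Rintegral_le => //; first exact: int_flow_measurable.
move=> u su ut; apply: le_trans (mx_entry_norm_le _ _ _) _.
by apply: AM; exact: le_trans su.
Qed.

Lemma int_flow_shift (gamma s t : R) : 0 <= s -> s <= t ->
  int_flow (fun u => A u - gamma%:M) s t = int_flow A s t - (gamma * (t - s))%:M.
Proof.
move=> s0 st; apply/matrixP => i j; rewrite !mxE.
have -> : \int[@lebesgue_measure R]_(u in `[s, t]) (A u - gamma%:M) i j =
    \int[@lebesgue_measure R]_(u in `[s, t]) (A u i j - gamma *+ (i == j)).
  by apply: eq_Rintegral => u _; rewrite !mxE.
rewrite RintegralB //; first 1 last.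
- exact: int_flow_integrable.
- by apply: (@bounded_integrable _ _ _ `|gamma *+ (i == j)|) => // *;
  exact: measurable_cst.
- by rewrite Rintegral_cst_itv // mulrnAl.
Qed.

Lemma int_flow_additive (s t : R) (i j : 'I_n) : 0 <= s -> s <= t ->
  int_flow A s t i j = int_flow A 0 t i j - int_flow A 0 s i j.
Proof.
move=> s0 st; rewrite !mxE; apply: Rintegral_itv_split => //.
by apply: int_flow_integrable => //; exact: le_trans st.
Qed.

Lemma int_flow_mulmx (W : 'M[R]_n) (s t : R) (i j : 'I_n) : 0 <= s -> s <= t ->
  (int_flow A s t *m W) i j =
  \int[@lebesgue_measure R]_(u in `[s, t]) (A u *m W) i j.
Proof.
move=> s0 st; rewrite mxE /Rintegral.
have -> : (\int[@lebesgue_measure R]_(u in `[s, t]) ((A u *m W) i j)%:E =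
    \int[@lebesgue_measure R]_(u in `[s, t]) \sum_(k < n) (A u i k * W k j)%:E)%E.
  by apply: eq_integral => u _; rewrite mxE sumEFin.
have ms : measurable (`[s, t] : set (measurableTypeR R)) by [].
have intAW k : (@lebesgue_measure R).-integrable `[s, t]
    (EFin \o (fun u => A u i k * W k j)).
  have := integrableZr ms (W k j) (int_flow_integrable s t i k s0 st).
  by apply: eq_integrable => // u _; rewrite /= EFinM.
rewrite integral_sum //.
have finE k : (\int[@lebesgue_measure R]_(u in `[s, t]) (A u i k * W k j)%:E
    = (int_flow A s t i k * W k j)%:E)%E.
  rewrite mxE -RintegralZr //; last exact: int_flow_integrable.
  by rewrite /Rintegral fineK //; exact: integrable_fin_num ms _ (intAW k).
by under [in RHS]eq_bigr do rewrite finE; rewrite sumEFin.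
Qed.

(** Two uses of the integral equation: it first shows that Phi is Lipschitz on
    [0, T], so that replacing Phi(u) by Phi(s) under the integral costs O(u - s),
    which integrates to O((t - s)^2). *)
Lemma fundamental_matrix_quad (Phi : R -> 'M[R]_n) :
  fundamental_matrix `[0, +oo[ A Phi -> quad_solution 0 (int_flow A) Phi.
Proof.
move=> [cPhi _ PhiE] T.
have M0 := int_flow_bound.
have cT : {within `[0, T], continuous Phi}.
  by apply: continuous_subspaceW cPhi; exact: subset_itvl.
have [Z Z0 PhiZ] := within_itv_bounded _ _ _ cT.
have mPhi (s t : R) (i j : 'I_n) : 0 <= s -> s <= t ->
  measurable_fun `[s, t] (fun u => Phi u i j).
  move=> s0 st; apply: subspace_continuous_measurable_fun => //.
  apply: (@within_continuous_comp _ _ _ _ Phi (fun N : 'M[R]_n => N i j)).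
    by move=> x _; exact: coord_continuous.
  apply: continuous_subspaceW cPhi.
  by apply: subset_itv; rewrite bnd_simp.
have mAW (W : R -> 'M[R]_n) (s t : R) (i j : 'I_n) : 0 <= s -> s <= t ->
    (forall k, measurable_fun `[s, t] (fun u => W u k j)) ->
    measurable_fun `[s, t] (fun u => (A u *m W u) i j).
  move=> s0 st mW.
  have -> : (fun u => (A u *m W u) i j) = (fun u => \sum_k A u i k * W u k j).
    by apply/funext => u; rewrite mxE.
  apply: measurable_sum => k; apply: measurable_funM => //.
  exact: int_flow_measurable.
have PhiE' (s t : R) (i j : 'I_n) : 0 <= s -> s <= t -> Phi t i j - Phi s i j =
    \int[@lebesgue_measure R]_(u in `[s, t]) (A u *m Phi u) i j.
  move=> s0 st; rewrite (PhiE s t) ?in_itv /= ?s0 ?(le_trans s0 st) //.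
  by rewrite addrC addKr.
have PhiL (s t : R) : 0 <= s -> s <= t -> t <= T ->
  `|Phi t - Phi s| <= n%:R * M * Z * (t - s).
  move=> s0 st tT; apply: mx_norm_le => [|i j].
    by rewrite !mulr_ge0 // subr_ge0.
  rewrite !mxE PhiE' //; apply: norm_Rintegral_le => //.
    by apply: mAW => // k; exact: mPhi.
  move=> u su ut; apply: le_trans (mx_entry_norm_le _ _ _) _.
  apply: le_trans (mulmx_norm_le _ _) _.
  have u0 := le_trans s0 su.
  by rewrite ler_pM ?mulr_ge0 // ?ler_wpM2l ?AM // PhiZ // (le_trans ut).
exists (n%:R * M * (n%:R * M * Z)); first by rewrite !mulr_ge0.
move=> s t s0 st tT; apply: mx_norm_le => [|i j].
  by rewrite mulr_ge0 ?sqr_ge0 // !mulr_ge0.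
have -> : (Phi t - Phi s - int_flow A s t *m Phi s) i j =
    \int[@lebesgue_measure R]_(u in `[s, t]) (A u *m (Phi u - Phi s)) i j.
  rewrite 2!mxE [(- Phi s) i j]mxE PhiE' // [in X in _ + X]mxE int_flow_mulmx //.
  rewrite -RintegralB //.
  - by apply: eq_Rintegral => u _;
    rewrite mulmxBr [in RHS]mxE [in X in _ = _ + X]mxE.
  - apply: (@bounded_integrable _ _ _ (n%:R * M * Z)).
      by apply: mAW => // k; exact: mPhi.
    move=> u su ut; apply: le_trans (mx_entry_norm_le _ _ _) _.
    apply: le_trans (mulmx_norm_le _ _) _.
    have u0 := le_trans s0 su.
    by rewrite ler_pM ?mulr_ge0 // ?ler_wpM2l ?AM // PhiZ // (le_trans ut).
  - apply: (@bounded_integrable _ _ _ (n%:R * M * Z)).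
      by apply: mAW => // k; exact: measurable_cst.
    move=> u su ut; apply: le_trans (mx_entry_norm_le _ _ _) _.
    apply: le_trans (mulmx_norm_le _ _) _.
    have u0 := le_trans s0 su.
    by rewrite ler_pM ?mulr_ge0 // ?ler_wpM2l ?AM // PhiZ // (le_trans st).
have -> : n%:R * M * (n%:R * M * Z) * (t - s) ^+ 2 =
  n%:R * M * (n%:R * M * Z * (t - s)) * (t - s) by ring.
apply: norm_Rintegral_le => //.
  apply: mAW => // k.
  have -> : (fun u => (Phi u - Phi s) k j) = (fun u => Phi u k j - Phi s k j).
    by apply/funext => u; rewrite !mxE.
  by apply: measurable_funB; [exact: mPhi | exact: measurable_cst].
move=> u su ut; apply: le_trans (mx_entry_norm_le _ _ _) _.
apply: le_trans (mulmx_norm_le _ _) _.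
have u0 := le_trans s0 su.
rewrite ler_pM ?mulr_ge0 // ?ler_wpM2l ?AM //.
apply: le_trans (PhiL s u s0 su (le_trans ut tT)) _.
by rewrite ler_wpM2l ?mulr_ge0 // lerD2r.
Qed.

End bounded_system.

Lemma exp_dichotomy_quad {R : realType} {n : nat} (A : R -> 'M[R]_n) (M gamma :
  R) :
  loc_integrable_mx `[0, +oo[ A -> (forall t : R, 0 <= t -> `|A t| <= M) ->
  exp_dichotomy `[0, +oo[ (fun t => A t - gamma%:M) ->
  exists Phi P K alpha, quad_dichotomy (int_flow A) gamma Phi P K alpha.
Proof.
move=> Aint AM [Agint [Phi [P [K [alpha [fPhi PP [K1 a0] fwd bwd]]]]]].
have itv0 t : 0 <= t -> t \in `[0, +oo[ by move=> t0; rewrite in_itv /= t0.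
exists Phi, P, K, alpha; split => //.
- have AgM t : 0 <= t -> `|A t - gamma%:M| <= M + `|gamma|.
    move=> t0; rewrite (le_trans (ler_normB _ _)) // lerD ?AM //.
    exact: norm_scalar_mx_le.
  apply: eq_quad_solution _ (fundamental_matrix_quad _ _ Agint AgM _ fPhi).
  by move=> s t s0 st; exact: int_flow_shift.
- by case: fPhi => _ Phiu _ t t0; exact/Phiu/itv0.
- by move=> s t s0 st; apply: fwd => //; apply: itv0 => //; exact: le_trans st.
- by move=> s t t0 ts; apply: bwd => //; apply: itv0 => //; exact: le_trans ts.
Qed.

(** * A differential inequality with a measurable coefficient *)

(** The coefficient q is merely measurable, so the inequality is integrated through the
    continuous derivative dw. *)
Lemma FTC2_le {R : realType} (w dw q : R -> R) (a b M : R) :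
  a <= b -> {within `[a, b], continuous w} -> {within `[a, b], continuous dw} ->
  (forall u, a < u -> u < b -> is_derive u 1 w (dw u)) ->
  measurable_fun `[a, b] q -> (forall u, a <= u -> u <= b -> `|q u| <= M) ->
  (forall u, a <= u -> u <= b -> dw u <= q u) ->
  w b - w a <= \int[@lebesgue_measure R]_(u in `[a, b]) q u.
Proof.
rewrite le_eqVlt => /predU1P[-> _ _ _ _ _ _|ab cw cdw dwE mq qM dwq].
  by rewrite subrr set_itv1 Rintegral_set1.
have -> : w b - w a = \int[@lebesgue_measure R]_(u in `[a, b]) dw u.
  rewrite /Rintegral (@continuous_FTC2 _ dw w a b ab cdw) //.
    have /(continuous_within_itvP _ ab)[_ wa wb] := cw; split => //.
    by move=> u; rewrite in_itv /= => /andP[au ub]; have [] := dwE u au ub.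
  move=> u; rewrite in_itv /= => /andP[au ub].
  by rewrite derive1E; have := dwE u au ub => /@derive_val.
have [Z _ dwZ] := within_itv_bounded _ _ _ cdw.
apply: le_Rintegral => //.
- apply: (bounded_integrable _ _ Z) => //.
  exact: subspace_continuous_measurable_fun.
- exact: (bounded_integrable _ _ M).
- by move=> u /=; rewrite in_itv /= => /andP[au ub]; exact: dwq.
Qed.

(** Since w is Lipschitz, w may be frozen at time s in the integral of p w, at the price
    of a quadratic error; this is the form that [gronwall_quad] accepts. *)
Lemma gronwall_measurable {R : realType} (w dw p : R -> R) (a b M K kap c : R) :
  a <= b -> 0 < kap -> 0 <= c ->
  {within `[a, b], continuous w} -> {within `[a, b], continuous dw} ->
  (forall u, a < u -> u < b -> is_derive u 1 w (dw u)) ->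
  measurable_fun `[a, b] p -> (forall u, a <= u -> u <= b -> `|p u| <= M) ->
  (forall u, a <= u -> u <= b -> 0 <= w u) ->
  (forall u, a <= u -> u <= b -> dw u <= p u * w u + c) ->
  (forall s t, a <= s -> s <= t -> t <= b ->
     \int[@lebesgue_measure R]_(u in `[s, t]) p u <= K - kap * (t - s)) ->
  w b <= expR K * (w a + c / kap).
Proof.
move=> ab kap0 c0 cw cdw dwE mp pM w0 dwp pK.
have M0 : 0 <= M by apply: le_trans (normr_ge0 _) (pM a (lexx a) ab).
have sub s t : a <= s -> t <= b -> `[s, t] `<=` `[a, b].
  by move=> as_ tb; apply: subset_itv; rewrite bnd_simp.
have [D D0 dwD] := within_itv_bounded _ _ _ cdw.
have wL s t : a <= s -> s <= t -> t <= b -> `|w t - w s| <= D * (t - s).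
  move=> as_ st tb.
  have dst u : u \in `]s, t[ -> is_derive u 1 w (dw u).
    rewrite in_itv /= => /andP[su ut].
    by apply: dwE; [exact: le_lt_trans su | exact: lt_le_trans tb].
  have [e] := MVT_segment st dst (continuous_subspaceW (sub s t as_ tb) cw).
  rewrite in_itv /= => /andP[se et] ->.
  rewrite normrM (ger0_norm (x := t - s)) ?subr_ge0 // ler_wpM2r ?subr_ge0 //.
  by apply: dwD; [exact: le_trans se | exact: le_trans tb].
pose nu t := \int[@lebesgue_measure R]_(u in `[a, t]) p u.
have mps s t : a <= s -> t <= b -> measurable_fun `[s, t] p.
  by move=> as_ tb; apply: measurable_funS mp => //; exact: sub.
have intp s t : a <= s -> t <= b ->
    (@lebesgue_measure R).-integrable `[s, t] (EFin \o p).
  move=> as_ tb; apply: (bounded_integrable _ _ M); first exact: mps.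
  by move=> u su ut; apply: pM; [exact: le_trans su | exact: le_trans tb].
have nuE s t : a <= s -> s <= t -> t <= b ->
    \int[@lebesgue_measure R]_(u in `[s, t]) p u = nu t - nu s.
  by move=> as_ st tb; apply: Rintegral_itv_split => //; exact: intp.
have := @gronwall_quad _ w nu a b K kap c (M * D) ab kap0 c0 (mulr_ge0 M0 D0) w0.
have nuK t : a <= t -> t <= b -> nu b - nu t <= K - kap * (b - t).
  by move=> at_ tb; rewrite -nuE // pK.
move=> /(_ nuK) h.
have step s t : a <= s -> s <= t -> t <= b ->
   w t <= w s * (1 + (nu t - nu s)) + c * (t - s) + M * D * (t - s) ^+ 2.
  move=> as_ st tb.
  have st0 : 0 <= t - s by rewrite subr_ge0.
  (* The integrand with w frozen at s, plus the forcing and the freezing error. *)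
  pose q u := p u * w s + (c + M * D * (t - s)).
  have qint : \int[@lebesgue_measure R]_(u in `[s, t]) q u =
      (nu t - nu s) * w s + (c + M * D * (t - s)) * (t - s).
    rewrite RintegralD //.
    - by rewrite RintegralZr ?intp // nuE // Rintegral_cst_itv.
    - apply: (bounded_integrable _ _ (M * `|w s|)).
        by apply: measurable_funM; [exact: mps | exact: measurable_cst].
      move=> u su ut; rewrite normrM ler_wpM2r // pM //; first exact: le_trans su.
      exact: le_trans tb.
    - by apply: (bounded_integrable _ _ `|c + M * D * (t - s)|) => // *;
      exact: measurable_cst.
  have : w t - w s <= \int[@lebesgue_measure R]_(u in `[s, t]) q u.
    apply: (FTC2_le w dw q s t (M * `|w s| + `|c + M * D * (t - s)|)) => //.
    - exact: continuous_subspaceW (sub s t as_ tb) cw.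
    - exact: continuous_subspaceW (sub s t as_ tb) cdw.
    - by move=> u su ut; apply: dwE;
      [exact: le_lt_trans su | exact: lt_le_trans tb].
    - apply: measurable_funD; last exact: measurable_cst.
      by apply: measurable_funM; [exact: mps | exact: measurable_cst].
    - move=> u su ut; apply: le_trans (ler_normD _ _) _; rewrite lerD2r.
      rewrite normrM ler_wpM2r // pM //; first exact: le_trans su.
      exact: le_trans tb.
    - move=> u su ut.
      have au := le_trans as_ su; have ub := le_trans ut tb.
      apply: le_trans (dwp u au ub) _.
      have h1 : p u * (w u - w s) <= M * (D * (t - s)).
        apply: le_trans (ler_norm _) _; rewrite normrM.
        rewrite ler_pM // ?pM // (le_trans (wL s u as_ su ub)) //.
        by rewrite ler_wpM2l // lerD2r.
      by rewrite /q; lra.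
  by rewrite qint; lra.
apply: le_trans (h step) _.
have : expR (nu b - nu a) * w a <= expR K * w a.
  apply: ler_wpM2r; first exact: w0.
  rewrite ler_expR; apply: le_trans (nuK a (lexx a) ab) _.
  have : 0 <= kap * (b - a) by rewrite mulr_ge0 ?subr_ge0 // ltW.
  by lra.
by rewrite mulrDr lerD2r.
Qed.

(** * Jacobian matrices and the uniform Lipschitz constant *)

(** The difference quotients of s |-> f (x + s v) are literally those of f in the
    direction v. *)
Lemma is_derive_line {R : realType} {n : nat} (f : 'rV[R]_n -> 'rV[R]_n)
    (x v : 'rV[R]_n) (i : 'I_n) (s : R) :
  (forall y, differentiable f y) ->
  is_derive s 1 (fun s : R => f (x + s *: v) ord0 i)
    ((v *m 'J f (x + s *: v)) ord0 i).
Proof.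
move=> df.
have dv : derivable f (x + s *: v) v by exact: diff_derivable.
have lineE : (fun h : R => h^-1 *: (f (x + (h *: 1 + s) *: v) - f (x + s *: v))) =
    (fun h : R => h^-1 *: (f (h *: v + (x + s *: v)) - f (x + s *: v))).
  apply/funext => h; congr (_ *: (f _ - _)).
  by rewrite [h *: 1]mulr1 scalerDl addrCA.
have dline : derivable (fun s : R => f (x + s *: v)) s 1.
  exact: (eq_ind_r (fun g : R -> 'rV[R]_n => cvg (g @ 0^')) dv lineE).
have Dline : 'D_1 (fun s : R => f (x + s *: v)) s = v *m 'J f (x + s *: v).
  rewrite -(deriveEjacobian v (df _)).
  exact: (congr1 (fun g : R -> 'rV[R]_n => lim (g @ 0^')) lineE).
split; first by move/derivable_mxP : dline; apply.
by rewrite -Dline derive_mx // mxE.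
Qed.

Lemma line_MVT {R : realType} {n : nat} (f : 'rV[R]_n -> 'rV[R]_n)
    (x v : 'rV[R]_n) (i : 'I_n) :
  (forall y, differentiable f y) ->
  exists s : R, f (x + v) ord0 i - f x ord0 i = (v *m 'J f (x + s *: v)) ord0 i.
Proof.
move=> df.
have dl (s : R) : s \in `]0, 1[ -> is_derive s 1
    (fun s : R => f (x + s *: v) ord0 i) ((v *m 'J f (x + s *: v)) ord0 i).
  by move=> _; exact: is_derive_line.
have cl : {within `[0, 1], continuous (fun s : R => f (x + s *: v) ord0 i)}.
  apply: derivable_within_continuous => s _.
  by have [] := is_derive_line f x v i s df.
have [s _] := MVT ltr01 dl cl.
by rewrite scale1r scale0r addr0 subr0 mulr1 => h; exists s.
Qed.

Lemma delta_mul_jacobian {R : realType} {n : nat} (G : R -> 'rV[R]_n -> 'rV[R]_n)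
    (t : R) (x : 'rV[R]_n) (i j : 'I_n) (c : R) :
  ((c *: (delta_mx ord0 j : 'rV[R]_n)) *m 'J (G t) x) ord0 i = c * Jac G t x i j.
Proof.
by rewrite -scalemxAl -rowE /Jac !mxE.
Qed.

(** In the direction e_j with j < i the i-th component is constant. *)
Lemma Jac_triangular {R : realType} {n : nat} (G : R -> 'rV[R]_n -> 'rV[R]_n)
    (t : R) (x : 'rV[R]_n) (i j : 'I_n) :
  triangular G -> 0 <= t -> (forall y, differentiable (G t) y) -> (j < i)%N ->
  Jac G t x i j = 0.
Proof.
move=> Gtri t0 dG ji.
have := is_derive_line (G t) x (delta_mx ord0 j) i 0 dG.
have -> : (fun s : R => G t (x + s *: delta_mx ord0 j) ord0 i) = cst (G t x ord0 i).
  apply/funext => s; apply: Gtri => // k ik.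
  by rewrite !mxE eqxx -val_eqE gtn_eqF ?mulr0 ?addr0 // (leq_trans ji).
rewrite scale0r addr0 -[delta_mx _ _]scale1r delta_mul_jacobian mul1r => h.
by have := @derive_val _ _ _ _ _ _ _ h; rewrite derive_cst.
Qed.

Lemma Lipschitz_of_Jac_bound {R : realType} {n : nat}
    (G : R -> 'rV[R]_n -> 'rV[R]_n) (t M : R) :
  (forall y, differentiable (G t) y) -> (forall x, `|Jac G t x| <= M) ->
  forall x y, `|G t x - G t y| <= n%:R * M * `|x - y|.
Proof.
move=> dG JM x y.
have M0 : 0 <= M by apply: le_trans (normr_ge0 _) (JM x).
apply: mx_norm_le => [|i0 i]; first by rewrite !mulr_ge0.
rewrite !mxE (ord1 i0).
have [s] := line_MVT (G t) y (x - y) i dG; rewrite subrKC => ->.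
apply: le_trans (mx_entry_norm_le _ _ _) _.
apply: le_trans (mulmx_norm_le _ _) _.
rewrite mulrAC ler_wpM2r // ler_wpM2l //.
apply: mx_norm_le => // j k.
have -> : 'J (G t) (y + s *: (x - y)) j k = Jac G t (y + s *: (x - y)) k j.
  by rewrite [RHS]mxE.
by apply: le_trans (mx_entry_norm_le _ _ _) (JM _).
Qed.

Lemma measurable_countable_support {R : realType} (D Q : set R) (f : R -> R) :
  countable Q -> (forall t, ~ Q t -> f t = 0) -> measurable_fun D f.
Proof.
move=> cQ f0 mD Y mY; apply: measurableI => //.
have mcount (S : set R) : S `<=` Q -> measurable S.
  move=> SQ; apply: countable_measurable => //;
    exact: sub_countable (subset_card_le SQ) cQ.
have -> : f @^-1` Y = ((f @^-1` Y) `&` Q) `|` ((f @^-1` Y) `&` ~` Q).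
  by rewrite -setIUr setUCr setIT.
apply: measurableU; first by apply: mcount; exact: subIsetr.
have [Y0|Y0] := pselect (Y 0).
  have -> : (f @^-1` Y) `&` ~` Q = ~` Q.
    by apply/seteqP; split => [t []//|t nQ]; split => //=; rewrite f0.
  by apply: measurableC; exact: mcount.
have -> : (f @^-1` Y) `&` ~` Q = set0.
  by apply/seteqP; split => // t [/= Yt nQ]; apply: Y0; rewrite -(f0 t).
exact: measurable0.
Qed.

(** Only finitely many rationals have an index below N. *)
Lemma near_right_avoid_rat {R : realType} (t : R) (N : nat) :
  \forall u \near t^'+, forall q : rat, (pickle q < N)%N -> u != ratr q.
Proof.
elim: N => [|N IH]; first by apply: nearW.
have [[q qN]|nq] := pselect (exists q : rat, pickle q = N); last first.
  near=> u => p; rewrite ltnS leq_eqVlt => /predU1P[pN|]; first by case: nq;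
    exists p.
  by move: p; near: u.
have hq : \forall u \near t^'+, u != ratr q.
  have [tq|qt] := ltP t (ratr q).
    by near=> u; rewrite lt_eqF //; near: u; exact: nbhs_right_lt.
  by near=> u; rewrite gt_eqF // (le_lt_trans qt) //; near: u;
    exact: nbhs_right_gt.
near=> u => p; rewrite ltnS leq_eqVlt => /predU1P[pN|].
  have -> : p = q by apply: (pcan_inj pickleK); rewrite qN.
  by near: u.
by move: p; near: u.
Unshelve. all: by end_near. Qed.

(** A single measurable y must witness the size of the Jacobian at many times.  It is
    supported on the rationals: at the rational q of index k, y takes a value where
    the Jacobian exceeds k, if there is one, and otherwise a value where its norm is
    within 1 of its supremum.  If M bounds the Jacobian along y, then at all rational
    times of index larger than M the first case is excluded, and M + 1 bounds the
    Jacobian for all x.  The finitely many remaining rationals and all irrational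
    times follow from the continuity of G in t, because the Lipschitz estimate,
    unlike a bound on the Jacobian, passes to the limit. *)
Lemma uniform_Lipschitz {R : realType} {n : nat} (G : R -> 'rV[R]_n -> 'rV[R]_n) :
  (forall x : 'rV[R]_n, {within `[0, +oo[, continuous (fun t : R => G t x)}) ->
  (forall t : R, 0 <= t -> C1 (G t)) ->
  (forall y : R -> 'rV[R]_n, measurable_vector `[0, +oo[ y ->
      exists M : R, forall t : R, 0 <= t -> `|Jac G t (y t)| <= M) ->
  exists2 L : R, 0 <= L &
    forall t x y, 0 <= t -> `|G t x - G t y| <= L * `|x - y|.
Proof.
move=> Gt G1 GM.
pose near_sup (q : rat) (x : 'rV[R]_n) :=
  (pickle q)%:R < `|Jac G (ratr q) x| \/
  forall z, `|Jac G (ratr q) z| <= `|Jac G (ratr q) x| + 1.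
have near_supP q : exists x, near_sup q x.
  have [[x hx]|nx] := pselect (exists x, (pickle q)%:R < `|Jac G (ratr q) x|).
    by exists x; left.
  pose S := range (fun x => `|Jac G (ratr q) x|).
  have S_sup : has_sup S.
    split; first by exists (`|Jac G (ratr q) 0|), 0.
    exists (pickle q)%:R => _ [x _ <-]; rewrite leNgt; apply/negP => h.
    by apply: nx; exists x.
  have [_ [x _ <-] hx] := sup_adherent ltr01 S_sup.
  exists x; right => z; have : `|Jac G (ratr q) z| <= sup S.
    by apply: ub_le_sup; [case: S_sup | exists z].
  by rewrite -(lerD2r (- 1)) => /le_trans/(_ (ltW hx)); rewrite lerBlDr.
have [X Xsup] := choice near_supP.
pose y (t : R) : 'rV[R]_n := match pselect (exists q : rat, ratr q = t) with
  | left h => X (projT1 (cid h)) | right _ => 0 end.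
have yq q : y (ratr q) = X q.
  rewrite /y; case: pselect => [h|[]]; last by exists q.
  by congr X; case: (cid h) => p /= /fmorph_inj.
have my : measurable_vector `[0, +oo[ y.
  move=> j; apply: (@measurable_countable_support _ _ (range (ratr : rat -> R))).
    exact: sub_countable (card_image_le _ _) (countableP _).
  move=> t nt; rewrite /y; case: pselect => [[q qt]|_]; last by rewrite mxE.
  by case: nt; exists q.
have [M JM] := GM y my.
have M0 : 0 <= M by apply: le_trans (normr_ge0 _) (JM 0 (lexx 0)).
pose N := (Num.truncn M).+1.
have ratL q : (N <= pickle q)%N -> 0 <= ratr q :> R ->
    forall x z, `|G (ratr q) x - G (ratr q) z| <= n%:R * (M + 1) * `|x - z|.
  move=> Nq q0; apply: Lipschitz_of_Jac_bound; first by case: (G1 _ q0).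
  have := JM _ q0; rewrite yq => hM x.
  case: (Xsup q) => [hq|/(_ x)/le_trans]; last by apply; rewrite lerD2r.
  have : M < (pickle q)%:R.
    by apply: lt_le_trans (truncnS_gt M) _; rewrite ler_nat.
  by move=> /(le_lt_trans hM)/(lt_trans hq); rewrite ltxx.
exists (n%:R * (M + 1)) => [|t x z t0]; first by rewrite mulr_ge0 // addr_ge0.
rewrite leNgt; apply/negP => viol.
have near_viol : \forall u \near t^'+, n%:R * (M + 1) * `|x - z| < `|G u x - G u z|.
  have ct w : G u w @[u --> t^'+] --> G t w.
    move: (Gt w) => /continuous_within_itvcyP[c0 c00].
    move: t0; rewrite le_eqVlt => /predU1P[<-//|t0].
    by apply: cvg_at_right_filter; apply: c0; rewrite in_itv /= t0.
  have cn : `|G u x - G u z| @[u --> t^'+] --> `|G t x - G t z|.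
    by apply: cvg_norm; exact: cvgB.
  by move: cn => /cvgr_gt /(_ _ viol).
have := near_right_avoid_rat t N => near_avoid.
have : \forall u \near t^'+, n%:R * (M + 1) * `|x - z| < `|G u x - G u z| /\
    forall q : rat, (pickle q < N)%N -> u != ratr q.
  by near=> u; split; [near: u | near: u].
move=> [e /= e0 he].
have [q] := @rat_in_itvoo _ t (t + e) ltac:(by rewrite ltrDl).
rewrite in_itv /= => /andP[tq qe].
have [|viol_q avoid_q] := he (ratr q) _ tq.
  by rewrite /= distrC gtr0_norm ?subr_gt0 // ltrBlDl.
have q0 : 0 <= ratr q :> R by rewrite (le_trans t0) // ltW.
have [qN|Nq] := ltnP (pickle q) N.
  by have := avoid_q q qN; rewrite eqxx.
by move: viol_q; rewrite ltNge ratL.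
Unshelve. all: by end_near. Qed.

(** * A measurable bound for the diagonal of the Jacobian *)

Lemma measurable_nat_comp {R : realType} (D : set R) (k : R -> nat) (g : nat ->
  R) :
  (forall m, measurable (D `&` [set t | k t = m])) ->
  measurable_fun D (g \o k).
Proof.
move=> mk mD Y mY.
have -> : D `&` (g \o k) @^-1` Y =
    \bigcup_(m in [set m | Y (g m)]) (D `&` [set t | k t = m]).
  apply/seteqP; split => [t [Dt Yt]|t [m Ym [Dt kt]]]; first by exists (k t).
  by split => //=; rewrite kt.
by apply: bigcup_measurable => m _; exact: mk.
Qed.

Lemma row_rat_approx {R : realType} {n : nat} (a : 'rV[R]_n -> R) (x :
  'rV[R]_n) (e : R) :
  {for x, continuous a} -> 0 < e ->
  exists q : 'rV[rat]_n, a x <= a (map_mx ratr q) + e.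
Proof.
move=> ca e0; have /cvgrPdist_lt/(_ _ e0) := ca.
move=> /nbhs_ballP[r /= r0 hr].
have hq (j : 'I_n) : exists q : rat, `|x ord0 j - ratr q| < r.
  have [q] := @rat_in_itvoo _ (x ord0 j) (x ord0 j + r) ltac:(by rewrite ltrDl).
  rewrite in_itv /= => /andP[h1 h2]; exists q.
  by rewrite distrC gtr0_norm ?subr_gt0 // ltrBlDl.
have [q hq'] := choice hq.
exists (\row_j q j); have := hr (map_mx ratr (\row_j q j)).
have hb : ball x r (map_mx ratr (\row_j q j)).
  by split=> // i j; rewrite (ord1 i) !mxE; exact: hq'.
by move=> /(_ hb)/(le_lt_trans (ler_norm _))/ltW; rewrite lerBlDl addrC.
Qed.

(** y(t) is the first vector, in an enumeration of the rational ones, that is optimal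
    among the rational vectors up to e(t); by continuity in x it is then optimal up
    to e(t) among all vectors. *)
Lemma measurable_almost_maximizer {R : realType} {n : nat} (a : R ->
  'rV[R]_n -> R)
    (L : R) (e : R -> R) :
  (forall t : R, 0 <= t -> 0 < e t) -> measurable_fun `[(0 : R), +oo[ e ->
  (forall x, measurable_fun `[(0 : R), +oo[ (a ^~ x)) ->
  (forall t : R, 0 <= t -> continuous (a t)) ->
  (forall (t : R) x, 0 <= t -> a t x <= L) ->
  exists2 y : R -> 'rV[R]_n, measurable_vector `[0, +oo[ y &
    forall (t : R) x, 0 <= t -> a t x <= a t (y t) + e t.
Proof.
move=> e0 me ma ca aL.
pose q (k : nat) : 'rV[R]_n := map_mx ratr (odflt 0 (unpickle k :
  option 'rV[rat]_n)).
pose good t k := `[< forall m, a t (q m) <= a t (q k) + e t >].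
have good_ex t : 0 <= t -> exists k, good t k.
  move=> t0; pose S := range (fun k => a t (q k)).
  have Ssup : has_sup S.
    split; first by exists (a t (q 0%N)), 0%N.
    by exists L => _ [k _ <-]; exact: aL.
  have [_ [k _ <-] hk] := sup_adherent (e0 t t0) Ssup.
  exists k; apply/asboolP => m; rewrite -lerBlDr.
  apply: le_trans (ltW hk); rewrite lerD2r.
  by apply: ub_le_sup; [case: Ssup | exists m].
pose k t : nat := match pselect (exists k, good t k) with
  | left h => ex_minn h | right _ => 0%N end.
have kP t : 0 <= t -> good t (k t) /\ forall m, good t m -> (k t <= m)%N.
  move=> /good_ex h; rewrite /k; case: pselect => // h'.
  by case: ex_minnP.
have mgood m : measurable (`[(0 : R), +oo[ `&` [set t | good t m]).
  have -> : `[(0 : R), +oo[ `&` [set t | good t m] =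
      \bigcap_i (`[0, +oo[ `&` [set t | a t (q i) <= a t (q m) + e t]).
    apply/seteqP; split => [t [Dt /asboolP h] i _|t h]; first by split => //;
      exact: h.
    split; first by case: (h 0%N Logic.I).
    by apply/asboolP => i; case: (h i Logic.I).
  apply: bigcapT_measurable => i.
  by apply: measurable_fun_le => //; apply: measurable_funD.
exists (q \o k).
  move=> j; have := @measurable_nat_comp _ `[(0 :
    R), +oo[ k (fun m => q m ord0 j).
  apply=> m.
  have -> : `[(0 : R), +oo[ `&` [set t | k t = m] =
      (`[0, +oo[ `&` [set t | good t m]) `\`
        (\bigcup_(i in [set i | (i < m)%N]) (`[0, +oo[ `&` [set t | good t i])).
    apply/seteqP; split => [t [Dt kt]|t [[Dt gt] nt]].
      have t0 : 0 <= t by move: Dt; rewrite /= in_itv /= andbT.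
      have [gk mink] := kP t t0; split; first by rewrite -kt.
      by move=> [i /= im [_ gi]]; have := mink i gi; rewrite kt leqNgt im.
    have t0 : 0 <= t by move: Dt; rewrite /= in_itv /= andbT.
    have [gk mink] := kP t t0; split => //=.
    have km' := mink m gt.
    apply: anti_leq; rewrite km' andTb leqNgt; apply/negP => km.
    by apply: nt; exists (k t).
  apply: measurableD; first exact: mgood.
  by apply: bigcup_measurable => i _; exact: mgood.
move=> t x t0; rewrite leNgt; apply/negP => h.
have d0 : 0 < (a t x - (a t (q (k t)) + e t)) / 2 by rewrite divr_gt0 // subr_gt0.
have [p hp] := row_rat_approx (a t) x _ (ca t t0 x) d0.
have [/asboolP/(_ (pickle p)) + _] := kP t t0.
rewrite /q pickleK /= -/(q (k t)) => hm.
by have := le_trans hp (lerD hm (lexx _)); rewrite /q in d0 *; lra.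
Qed.

Lemma spectrum_neg_dichotomy {R : realType} {n : nat} (A : R -> 'M[R]_n) :
  ED_spectrum A `<=` `]-oo, 0[ ->
  forall gamma, 0 <= gamma ->
    exp_dichotomy `[0, +oo[ (fun t => A t - gamma%:M).
Proof.
move=> hA gamma g0; apply: contrapT => h.
by have := hA gamma h; rewrite /= in_itv /= ltNge g0.
Qed.

(** Local integrability is part of having a dichotomy, here for gamma = 0.  It provides
    the measurability in t of the Jacobian along y. *)
Lemma spectrum_neg_integrable {R : realType} {n : nat} (A : R -> 'M[R]_n) :
  ED_spectrum A `<=` `]-oo, 0[ -> loc_integrable_mx `[0, +oo[ A.
Proof.
move=> /spectrum_neg_dichotomy/(_ 0 (lexx 0))[+ _].
by congr loc_integrable_mx; apply/funext => t; rewrite raddf0 subr0.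
Qed.

Lemma triangular_spectrum_neg {R : realType} {n : nat} (A : R -> 'M[R]_n) (M :
  R) :
  (forall t : R, 0 <= t -> `|A t| <= M) ->
  (forall (t : R) (i j : 'I_n), 0 <= t -> (j < i)%N -> A t i j = 0) ->
  ED_spectrum A `<=` `]-oo, 0[ ->
  exists (K alpha : R), 0 < alpha /\ forall (i : 'I_n) (s t : R), 0 <= s ->
    s <= t ->
    \int[@lebesgue_measure R]_(u in `[s, t]) A u i i <= K - alpha * (t - s).
Proof.
move=> AM Atri specA.
have Aint := spectrum_neg_integrable A specA.
have ED gamma : 0 <= gamma ->
    exists Phi P K alpha, quad_dichotomy (int_flow A) gamma Phi P K alpha.
  move=> g0; exact: (exp_dichotomy_quad A M) (spectrum_neg_dichotomy A specA _ g0).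
have M0 := int_flow_bound A M AM.
have AL := int_flow_lipschitz A M Aint AM.
have [Phi [K [alpha edA]]] := uniformly_stable_of_dichotomies M _ M0 AL ED.
exists (ln K), alpha; split; first by case: edA => _ _ [_ []].
move=> i s t s0 st.
have Btri p q : 0 <= p -> p <= q -> forall j k : 'I_n, (k < j)%N ->
  int_flow A p q j k = 0.
  move=> p0 pq j k kj; rewrite mxE -[RHS](mul0r (q - p)) -Rintegral_cst_itv //.
  apply: eq_Rintegral => u; rewrite inE /= in_itv /= => /andP[pu _].
  by apply: Atri => //; exact: le_trans pu.
have := diag_exponent_le M K alpha _ (fun t => int_flow A 0 t i i) Phi i M0 AL Btri
  (fun p q => int_flow_additive A Aint p q i i) edA s t s0 st.
by rewrite -int_flow_additive // mxE.
Qed.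

Lemma derive_le_Lipschitz {R : realType} (f : R -> R) (d L : R) :
  is_derive (0 : R) 1 f d -> (forall s, `|f s - f 0| <= L * `|s|) -> d <= L.
Proof.
move=> [df <-] fL; apply: limr_le; first exact: df.
near=> s; apply: le_trans (ler_norm _) _.
have s0 : s != 0 by near: s; exact: nbhs_dnbhs_neq.
rewrite normrZ normfV ler_pdivrMl ?normr_gt0 //= addr0.
by rewrite [s *: 1]mulr1 mulrC fL.
Unshelve. all: by end_near. Qed.

Lemma Jac_le_Lipschitz {R : realType} {n : nat} (G : R -> 'rV[R]_n -> 'rV[R]_n)
    (t L : R) (x : 'rV[R]_n) (i : 'I_n) :
  (forall y, differentiable (G t) y) -> 0 <= L ->
  (forall x y, `|G t x - G t y| <= L * `|x - y|) -> Jac G t x i i <= L.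
Proof.
move=> dG L0 GL; have := is_derive_line (G t) x (delta_mx ord0 i) i 0 dG.
rewrite scale0r addr0 -[X in X *m _]scale1r delta_mul_jacobian mul1r.
move=> /derive_le_Lipschitz; apply => s.
have := le_trans (mx_entry_norm_le _ ord0 i)
  (GL (x + s *: delta_mx ord0 i) (x + 0 *: delta_mx ord0 i)).
rewrite !mxE => /le_trans; apply; apply: ler_wpM2l => //.
rewrite scale0r addr0 addrAC subrr add0r normrZ -[leRHS]mulr1 ler_wpM2l //.
by apply: mx_norm_le => // k l; rewrite mxE; case: (_ && _);
  rewrite ?normr1 ?normr0.
Qed.

(** p is the diagonal entry along an almost maximizer y plus the tolerance exp(- t).
    The tolerance has to be integrable on [0, +oo[: alpha depends on y, so a constant
    tolerance could not be chosen smaller than alpha in advance. *)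
Lemma diagonal_exponent {R : realType} {n : nat} (G : R -> 'rV[R]_n -> 'rV[R]_n)
    (L : R) (i : 'I_n) :
  triangular G -> (forall t : R, 0 <= t -> C1 (G t)) ->
  (forall y : R -> 'rV[R]_n, measurable_vector `[0, +oo[ y ->
      exists M : R, forall t : R, 0 <= t -> `|Jac G t (y t)| <= M) ->
  (forall y : R -> 'rV[R]_n, measurable_vector `[0, +oo[ y ->
      ED_spectrum (fun t : R => Jac G t (y t)) `<=` `]-oo, 0[) ->
  0 <= L -> (forall (t : R) x y, 0 <= t -> `|G t x - G t y| <= L * `|x - y|) ->
  exists (p : R -> R) (M K alpha : R),
    [/\ 0 < alpha,
        forall s t : R, 0 <= s -> measurable_fun `[s, t] p,
        forall t : R, 0 <= t -> `|p t| <= M,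
        forall (t : R) x, 0 <= t -> Jac G t x i i <= p t &
        forall s t : R, 0 <= s -> s <= t ->
          \int[@lebesgue_measure R]_(u in `[s, t]) p u <= K - alpha * (t - s)].
Proof.
move=> Gtri G1 G3 G4 L0 GL.
have mJ (y : R -> 'rV[R]_n) : measurable_vector `[0, +oo[ y ->
    measurable_fun `[(0 : R), +oo[ (fun t => Jac G t (y t) i i).
  move=> my; have Jint := spectrum_neg_integrable _ (G4 y my).
  have -> : `[(0 : R), +oo[%classic = \bigcup_m (`[0, m%:R]%classic : set R).
    apply/seteqP; split => [t /=|t [m _ /=]]; rewrite !in_itv /=.
      rewrite andbT => t0; exists (Num.truncn t).+1 => //=.
      by rewrite in_itv /= t0 ltW // truncnS_gt.
    by move=> /andP[->].
  apply/measurable_fun_bigcup => // m.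
  exact: (int_flow_measurable _ Jint 0 m%:R i i).
have JL t x : 0 <= t -> Jac G t x i i <= L.
  move=> t0; have [dG _] := G1 t t0; by apply: Jac_le_Lipschitz => // y z;
    exact: GL.
pose a (t : R) x : R := Jac G t x i i.
have ca t : 0 <= t -> continuous (a t).
  move=> t0 x; have [_ cJ] := G1 t t0.
  have -> : a t = (fun N : 'M[R]_n => N i i) \o (fun x => 'J (G t) x).
    by apply/funext => z; rewrite /a /Jac /= mxE.
  by apply: continuous_comp; [exact: cJ | exact: coord_continuous].
have me : measurable_fun `[(0 : R), +oo[ (fun t : R => expR (- t)).
  by apply: measurableT_comp => //; exact: measurable_funN.
have ma x : measurable_fun `[(0 : R), +oo[ (a ^~ x).
  by apply: (mJ (fun=> x)) => j; exact: measurable_cst.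
have [y my ymax] := measurable_almost_maximizer a L (fun t => expR (- t))
  (fun t _ => expR_gt0 _) me ma ca JL.
have [M JM] := G3 y my.
have Jtri (t : R) (j k : 'I_n) : 0 <= t -> (k < j)%N -> Jac G t (y t) j k = 0.
  by move=> t0; apply: Jac_triangular => //; case: (G1 t t0).
have [K [alpha [a0 hK]]] := triangular_spectrum_neg _ M JM Jtri (G4 y my).
have mp (s t : R) : 0 <= s -> measurable_fun `[s, t] (fun t => Jac G t (y t) i i).
  move=> s0; apply: measurable_funS (mJ y my) => //.
  by apply: subset_itv; rewrite bnd_simp.
have mes (s t : R) : measurable_fun `[s, t] (fun t : R => expR (- t)).
  by apply: measurableT_comp => //; exact: measurable_funN.
have JM' t : 0 <= t -> `|Jac G t (y t) i i| <= M.
  by move=> t0; apply: le_trans (mx_entry_norm_le _ _ _) (JM t t0).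
have e1 (t : R) : 0 <= t -> `|expR (- t)| <= 1 :> R.
  by move=> t0; rewrite ger0_norm ?expR_ge0 // expR_le1 oppr_le0.
exists (fun t => Jac G t (y t) i i + expR (- t)), (M + 1), (K + 1), alpha;
  split => //.
- by move=> s t s0; apply: measurable_funD; [exact: mp | exact: mes].
- by move=> t t0; rewrite (le_trans (ler_normD _ _)) // lerD ?JM' ?e1.
- move=> s t s0 st; rewrite RintegralD //; first last.
  + apply: (bounded_integrable _ _ 1); first exact: mes.
    by move=> u su _; apply: e1; exact: le_trans su.
  + apply: (bounded_integrable _ _ M); first exact: mp.
    by move=> u su _; apply: JM'; exact: le_trans su.
  rewrite addrAC lerD ?hK //.
  have dexp (u : R) : is_derive u 1 (fun v : R => expR (- v)) (-1 * expR (- u)).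
    by apply: is_derive_eq; rewrite mulrC.
  have cexp : continuous (fun v : R => expR (- v)).
    by move=> u; apply/differentiable_continuous/derivable1_diffP; case: (dexp u).
  have := @FTC2_le _ (fun v => expR (- v)) (fun v => -1 * expR (- v))
    (fun v => -1 * expR (- v)) s t 1 st.
  rewrite RintegralZl //; last first.
    apply: (bounded_integrable _ _ 1); first exact: mes.
    by move=> u su _; apply: e1; exact: le_trans su.
  have h : expR (- s) <= 1 by rewrite expR_le1 oppr_le0.
  have h' := expR_ge0 (- t).
  suff : forall I : R, expR (- t) - expR (- s) <= -1 * I -> I <= 1.
    move=> hI H; apply: hI; apply: H.
    + exact: continuous_subspaceT.
    + by apply: continuous_subspaceT => u; apply: cvgM;
      [exact: cvg_cst | exact: cexp].
    + by apply: measurable_funM; [exact: measurable_cst | exact: mes].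
    + by move=> u su _; rewrite mulN1r normrN e1 // (le_trans s0).
    + by [].
  by move=> I hI; lra.
Qed.

(** * Decay of the components *)

Lemma within_continuous_field {R : realType} {n : nat}
    (G : R -> 'rV[R]_n -> 'rV[R]_n) (x : R -> 'rV[R]_n) (L a b : R) :
  (forall z : 'rV[R]_n, {within `[0, +oo[, continuous (fun t : R => G t z)}) ->
  0 <= L -> (forall (t : R) y z, 0 <= t -> `|G t y - G t z| <= L * `|y - z|) ->
  0 <= a -> {within `[a, b], continuous x} ->
  {within `[a, b], continuous (fun t : R => G t (x t))}.
Proof.
move=> Gt L0 GL a0 /subspace_continuousP cx; apply/subspace_continuousP => u uab.
have u0 : 0 <= u by move: uab; rewrite /= in_itv /= => /andP[/(le_trans a0)].
apply/cvgrPdist_le => e e0.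
have cG : G v (x u) @[v --> within `[a, b] (nbhs u)] --> G u (x u).
  have /subspace_continuousP sub : {within `[a, b], continuous (fun t :
    R => G t (x u))}.
    by apply: continuous_subspaceW (Gt (x u)); apply: subset_itv;
      rewrite bnd_simp.
  exact: sub.
have /cvgrPdist_le/(_ (e / 2)) near1 := cG.
have /cvgrPdist_le/(_ (e / (2 * (L + 1)))) near2 := cx u uab.
have L1 : 0 < L + 1 by lra.
have near1' := near1 ltac:(by rewrite divr_gt0).
have near2' := near2 ltac:(by rewrite divr_gt0 // mulr_gt0).
near=> v.
have v0 : 0 <= v.
  have : `[a, b]%classic v by near: v; exact: withinT.
  by rewrite /= in_itv /= => /andP[av _]; exact: le_trans av.
have -> : G u (x u) - G v (x v) = (G u (x u) - G v (x u)) + (G v (x u) - G v (x v)).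
  by rewrite addrA subrK.
apply: le_trans (ler_normD _ _) _.
rewrite (splitr e) lerD //; first by near: v.
apply: le_trans (GL _ _ _ v0) _.
have h : `|x u - x v| <= e / (2 * (L + 1)) by near: v.
apply: le_trans (ler_wpM2l L0 h) _.
have -> : L * (e / (2 * (L + 1))) = e / 2 * (L / (L + 1)) by field;
  rewrite gt_eqF.
by rewrite -[leRHS]mulr1 ler_wpM2l ?divr_ge0 // ?ltW // ltr_pdivrMr //
  mul1r ltrDl.
Unshelve. all: by end_near. Qed.

(** The point z keeps the components after i and has 0 elsewhere, so that
    G_i(t, x) = G_i(t, z + x_i e_i).  The increment from z is x_i times a diagonal
    entry of the Jacobian; the value at z is at most L |z|, and Young's inequality
    separates it from x_i. *)
Lemma component_ineq {R : realType} {n : nat} (G : R -> 'rV[R]_n -> 'rV[R]_n)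
    (L t p alpha X : R) (x : 'rV[R]_n) (i : 'I_n) :
  triangular G -> 0 <= t -> (forall y, differentiable (G t) y) -> G t 0 = 0 ->
  0 <= L -> (forall y z, `|G t y - G t z| <= L * `|y - z|) ->
  (forall z, Jac G t z i i <= p) -> 0 < alpha -> 0 <= X ->
  (forall j : 'I_n, (i < j)%N -> x ord0 j ^+ 2 <= X) ->
  2 * x ord0 i * G t x ord0 i <= (2 * p + alpha) * x ord0 i ^+ 2 + L ^+ 2 * X / alpha.
Proof.
move=> Gtri t0 dG G0 L0 GL Jp a0 X0 xX.
pose z : 'rV[R]_n := \row_j (if (i < j)%N then x ord0 j else 0).
pose v : 'rV[R]_n := x ord0 i *: (delta_mx ord0 i : 'rV[R]_n).
have -> : G t x ord0 i = G t (z + v) ord0 i.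
  apply: Gtri => // j; rewrite leq_eqVlt !mxE eqxx /= => /predU1P[ij|ij].
    by have -> : j = i by [apply: val_inj]; rewrite ltnn eqxx mulr1 add0r.
  by rewrite ij -val_eqE gtn_eqF // mulr0 addr0.
have [s] := line_MVT (G t) z v i dG; rewrite delta_mul_jacobian => Gv.
set Gz := G t z ord0 i in Gv *; set J := Jac _ _ _ _ _ in Gv.
have JL : J <= p by exact: Jp.
have zX : `|z| <= Num.sqrt X.
  apply: mx_norm_le => [|k j]; first exact: sqrtr_ge0.
  rewrite (ord1 k) mxE; case: ifP => ij; last by rewrite normr0 sqrtr_ge0.
  by rewrite -sqrtr_sqr ler_sqrt // xX.
have GzX : `|Gz| <= L * Num.sqrt X.
  have := GL z 0; rewrite G0 !subr0 => h.
  apply: le_trans (mx_entry_norm_le _ _ _) _; apply: le_trans h _.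
  exact: ler_wpM2l.
set xi := x ord0 i in Gv *.
have -> : G t (z + v) ord0 i = xi * J + Gz by rewrite -Gv subrK.
have h1 : xi ^+ 2 * J <= xi ^+ 2 * p by rewrite ler_wpM2l // sqr_ge0.
have h2 : xi * Gz <= `|xi| * (L * Num.sqrt X).
  by apply: le_trans (ler_norm _) _; rewrite normrM ler_wpM2l.
have h3 : 2 * (`|xi| * (L * Num.sqrt X)) <= alpha * xi ^+ 2 + L ^+ 2 * X / alpha.
  rewrite -(ler_pM2l a0) mulrDr [alpha * (_ / _)]mulrC divfK ?gt_eqF //.
  rewrite -(real_normK (num_real xi)) -{2}(sqr_sqrtr X0).
  have := sqr_ge0 (alpha * `|xi| - L * Num.sqrt X); nra.
lra.
Qed.

(** [gronwall_measurable] for w(u) = exp(delta' (u - a)) x_i(u)^2: the weight turns the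
    exponentially decaying forcing coming from the components j > i into a constant. *)
Lemma component_decay {R : realType} {n : nat} (G : R -> 'rV[R]_n -> 'rV[R]_n)
    (L K alpha M C delta delta' : R) (p : R -> R) (i : 'I_n) :
  triangular G ->
  (forall z : 'rV[R]_n, {within `[0, +oo[, continuous (fun t : R => G t z)}) ->
  (forall t : R, 0 <= t -> C1 (G t)) ->
  (forall t : R, 0 <= t -> G t 0 = 0) ->
  0 <= L -> (forall (t : R) y z, 0 <= t -> `|G t y - G t z| <= L * `|y - z|) ->
  0 < alpha -> (forall s t : R, 0 <= s -> measurable_fun `[s, t] p) ->
  (forall t : R, 0 <= t -> `|p t| <= M) ->
  (forall (t : R) x, 0 <= t -> Jac G t x i i <= p t) ->
  (forall s t : R, 0 <= s -> s <= t ->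
     \int[@lebesgue_measure R]_(u in `[s, t]) p u <= K - alpha * (t - s)) ->
  0 <= C -> 0 < delta' -> delta' <= delta -> delta' < alpha ->
  forall (a b : R) (x : R -> 'rV[R]_n), 0 <= a -> a <= b ->
  {within `[a, b], continuous x} ->
  (forall u, a < u -> u < b -> is_derive u (1 : R) x (G u (x u))) ->
  (forall (j : 'I_n) u, (i < j)%N -> a <= u -> u <= b ->
     x u ord0 j ^+ 2 <= C * `|x a| ^+ 2 * expR (- delta * (u - a))) ->
  x b ord0 i ^+ 2 <=
    expR (2 * K) * (1 + L ^+ 2 * C / alpha / (alpha - delta')) * `|x a| ^+ 2 *
      expR (- delta' * (b - a)).
Proof.
move=> Gtri Gt G1 G0 L0 GL a0 mp pM Jp pK C0 d'0 d'd d'a s0 b x s00 s0b cx dx xC.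
pose xi (u : R) : R := x u ord0 i.
pose gi (u : R) : R := G u (x u) ord0 i.
pose e u := expR (delta' * (u - s0)).
pose w u := e u * xi u ^+ 2.
pose dw u := e u * (delta' * xi u ^+ 2 + 2 * xi u * gi u).
pose c := L ^+ 2 * (C * `|x s0| ^+ 2) / alpha.
have N0 : 0 <= C * `|x s0| ^+ 2 by rewrite mulr_ge0 ?sqr_ge0.
have c0 : 0 <= c by rewrite /c !mulr_ge0 ?sqr_ge0 ?invr_ge0 // ltW.
have ad : 0 < alpha - delta' by rewrite subr_gt0.
have ccoord (y : R -> 'rV[R]_n) : {within `[s0, b], continuous y} ->
    {within `[s0, b], continuous (fun u => y u ord0 i)}.
  move=> cy; apply: (@within_continuous_comp _ _ _ _ y (fun N :
    'rV[R]_n => N ord0 i)) => //.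
  by move=> z _; exact: coord_continuous.
have cxi : {within `[s0, b], continuous xi} by exact: ccoord.
have cgi : {within `[s0, b], continuous gi}.
  by apply: ccoord; exact: (within_continuous_field G x L).
have de (u : R) : is_derive u 1 e (delta' * e u).
  have h : is_derive u 1 (fun u : R => delta' * (u - s0)) delta'.
    by apply: is_derive_eq; rewrite /= subr0 [_ *: 1]mulr1 ?mulr1.
  by apply: is_derive_eq; rewrite mulrC.
have ce : {within `[s0, b], continuous e}.
  apply: continuous_subspaceT => u.
  by apply/differentiable_continuous/derivable1_diffP; case: (de u).
have cM (f g : R -> R) : {within `[s0, b], continuous f} ->
    {within `[s0, b], continuous g} ->
      {within `[s0, b], continuous (fun u => f u * g u)}.
  by move=> cf cg u; apply: continuousM; [exact: cf | exact: cg].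
have cD (f g : R -> R) : {within `[s0, b], continuous f} ->
    {within `[s0, b], continuous g} ->
      {within `[s0, b], continuous (fun u => f u + g u)}.
  by move=> cf cg u; apply: continuousD; [exact: cf | exact: cg].
have cc (k : R) : {within `[s0, b], continuous (fun=> k)}.
  by apply: continuous_subspaceT => u; exact: cvg_cst.
have cw : {within `[s0, b], continuous w} by do 2!apply: (@cM) => //.
have cdw : {within `[s0, b], continuous dw}.
  by apply: (@cM) => //; apply: (@cD); do 2!apply: (@cM) => //.
have dxi (u : R) : s0 < u -> u < b -> is_derive u 1 xi (gi u).
  move=> su ub; have [hd hv] := dx u su ub.
  split; first by move/derivable_mxP : hd; apply.
  by rewrite /gi -hv derive_mx // mxE.
have dwE (u : R) : s0 < u -> u < b -> is_derive u 1 w (dw u).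
  move=> su ub; have h := dxi u su ub; have h' := de u.
  rewrite /w /dw; apply: is_derive_eq.
  rewrite /GRing.scale /=; ring.
have w0 u : s0 <= u -> u <= b -> 0 <= w u.
  by move=> _ _; rewrite mulr_ge0 ?expR_ge0 ?sqr_ge0.
pose p' u := 2 * p u + (alpha + delta').
have mp' (s t : R) : 0 <= s -> measurable_fun `[s, t] p'.
  move=> s0'; apply: measurable_funD; last exact: measurable_cst.
  by apply: measurable_funM; [exact: measurable_cst | exact: mp].
have p'M u : s0 <= u -> u <= b -> `|p' u| <= 2 * M + (alpha + delta').
  move=> su _; apply: le_trans (ler_normD _ _) _.
  rewrite normrM (ger0_norm (x := 2)) // (ger0_norm (x := alpha + delta'));
    last by lra.
  by rewrite lerD2r ler_wpM2l // pM // (le_trans s00).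
have p'K (s t : R) : s0 <= s -> s <= t -> t <= b ->
    \int[@lebesgue_measure R]_(u in `[s, t]) p' u <= 2 * K - (alpha - delta') * (t - s).
  move=> ss st tb; have s0' := le_trans s00 ss.
  have intp : (@lebesgue_measure R).-integrable `[s, t] (EFin \o p).
    apply: (bounded_integrable _ _ M); first exact: mp.
    by move=> u su _; apply: pM; exact: le_trans su.
  have int2p : (@lebesgue_measure R).-integrable `[s, t] (EFin \o (fun u => 2 * p u)).
    apply: (bounded_integrable _ _ (2 * M)).
      by apply: measurable_funM; [exact: measurable_cst | exact: mp].
    move=> u su _; rewrite normrM ger0_norm // ler_wpM2l //.
    by apply: pM; exact: le_trans su.
  have intc : (@lebesgue_measure R).-integrable `[s, t] (EFin \o (fun=> alpha + delta')).
    by apply: (bounded_integrable _ _ `|alpha + delta'|) => //;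
      exact: measurable_cst.
  rewrite RintegralD // RintegralZl // Rintegral_cst_itv //.
  have := pK s t s0' st; lra.
have dwp u : s0 <= u -> u <= b -> dw u <= p' u * w u + c.
  move=> su ub; have u0 := le_trans s00 su.
  have [dG _] := G1 u u0.
  have X0 : 0 <= C * `|x s0| ^+ 2 * expR (- delta * (u - s0)) by
    rewrite mulr_ge0 ?expR_ge0.
  have h := component_ineq G L u (p u) alpha _ (x u) i Gtri u0 dG (G0 u u0) L0
    (fun y z => GL u y z u0) (fun z => Jp u z u0) a0 X0
    (fun j ij => xC j u ij su ub).
  have e0 : 0 <= e u by exact: expR_ge0.
  have h1 : e u * (delta' * xi u ^+ 2 + 2 * xi u * gi u) <= e u * (delta' * xi u ^+ 2 +
     ((2 * p u + alpha) * xi u ^+ 2 + L ^+ 2 * (C * `|x s0| ^+ 2 * expR (- delta * (u - s0))) / alpha)).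
    by rewrite ler_wpM2l // lerD2l.
  apply: le_trans h1 _.
  have ee : e u * expR (- delta * (u - s0)) <= 1.
    rewrite -expRD -mulrDl expR_le1 mulr_le0_ge0 ?subr_ge0 //; lra.
  have := ler_wpM2l c0 ee; rewrite /c /w /p'; lra.
have := gronwall_measurable w dw p' s0 b (2 * M + (alpha + delta')) (2 * K)
  (alpha - delta') c s0b ad c0 cw cdw dwE (mp' s0 b s00) p'M w0 dwp p'K.
rewrite {2}/w /e subrr mulr0 expR0 mul1r => hw.
have xs0 : xi s0 ^+ 2 <= `|x s0| ^+ 2.
  rewrite -(real_normK (num_real (xi s0))) ler_pXn2r ?nnegrE //.
  exact: mx_entry_norm_le.
have xb : x b ord0 i ^+ 2 = w b * expR (- delta' * (b - s0)).
  rewrite /w /e mulrAC -expRD.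
  by have -> : delta' * (b - s0) + - delta' * (b - s0) = 0; [ring |
    rewrite expR0 mul1r].
rewrite xb ler_wpM2r ?expR_ge0 //; apply: le_trans hw _.
rewrite -mulrA ler_wpM2l ?expR_ge0 // mulrDl mul1r lerD //.
by rewrite le_eqVlt; apply/orP; left; apply/eqP; rewrite /c; field;
  rewrite !gt_eqF.
Qed.

Lemma solution_segment {R : realType} {n : nat} (G : R -> 'rV[R]_n -> 'rV[R]_n)
    (t0 : R) (T : \bar R) (x : R -> 'rV[R]_n) (b : R) :
  solution G t0 T x -> (b%:E < T)%E ->
  {within `[t0, b], continuous x} /\
  forall u, t0 < u -> u < b -> is_derive u (1 : R) x (G u (x u)).
Proof.
move=> [cx dx] bT; split.
  apply: continuous_subspaceW cx => u /=; rewrite in_itv /= => /andP[tu ub].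
  by split=> //; apply: le_lt_trans bT; rewrite lee_fin.
by move=> u tu ub; apply: dx => //; apply: lt_trans bT; rewrite lte_fin.
Qed.

Lemma components_decay {R : realType} {n : nat} (G : R -> 'rV[R]_n -> 'rV[R]_n) :
  triangular G ->
  (forall z : 'rV[R]_n, {within `[0, +oo[, continuous (fun t : R => G t z)}) ->
  (forall t : R, 0 <= t -> C1 (G t)) ->
  (forall t : R, 0 <= t -> G t 0 = 0) ->
  (forall y : R -> 'rV[R]_n, measurable_vector `[0, +oo[ y ->
      exists M : R, forall t : R, 0 <= t -> `|Jac G t (y t)| <= M) ->
  (forall y : R -> 'rV[R]_n, measurable_vector `[0, +oo[ y ->
      ED_spectrum (fun t : R => Jac G t (y t)) `<=` `]-oo, 0[) ->
  forall m : nat, exists (C delta : R), [/\ 0 <= C, 0 < delta &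
    forall (t0 : R) (T : \bar R) (x : R -> 'rV[R]_n), 0 <= t0 ->
      solution G t0 T x ->
    forall (t : R) (j : 'I_n), (n - m <= j)%N -> t0 <= t -> (t%:E < T)%E ->
      x t ord0 j ^+ 2 <= C * `|x t0| ^+ 2 * expR (- delta * (t - t0))].
Proof.
move=> Gtri Gt G1 G0 G3 G4.
have [L L0 GL] := uniform_Lipschitz G Gt G1 G3.
elim=> [|m [C [delta [C0 d0 IH]]]].
  exists 0, 1; split => // t0 T x _ _ t j; rewrite subn0 leqNgt.
  by rewrite (ltn_ord j).
have [nm|mn] := leqP n m.
  exists C, delta; split => // t0 T x t00 sx t j _; apply: IH => //.
  by move: nm; rewrite -subn_eq0 => /eqP ->.
have inn : (n - m.+1 < n)%N by rewrite ltn_subrL /= (leq_ltn_trans _ mn).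
pose i := Ordinal inn.
have [p [M [K [alpha [a0 mp pM Jp pK]]]]] :=
  diagonal_exponent G L i Gtri G1 G3 G4 L0 GL.
pose delta' := Num.min delta alpha / 2.
have min0 : 0 < Num.min delta alpha by rewrite lt_min d0.
have d'0 : 0 < delta' by rewrite divr_gt0.
have d'd : delta' <= delta.
  have : Num.min delta alpha <= delta by rewrite ge_min lexx.
  by rewrite /delta'; lra.
have d'a : delta' < alpha.
  have : Num.min delta alpha <= alpha by rewrite ge_min lexx orbT.
  by rewrite /delta'; lra.
pose Ci := expR (2 * K) * (1 + L ^+ 2 * C / alpha / (alpha - delta')).
exists (Num.max C Ci), delta'; split => //; first by rewrite le_max C0.
move=> t0 T x t00 sx t j ij t0t tT.
have [cx dx] := solution_segment G t0 T x t sx tT.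
have N0 : 0 <= `|x t0| ^+ 2 by exact: sqr_ge0.
have [ij'|ji] := leqP (n - m) j.
  apply: le_trans (IH t0 T x t00 sx t j ij' t0t tT) _.
  apply: ler_pM; rewrite ?mulr_ge0 ?expR_ge0 //.
    by rewrite ler_wpM2r // le_max lexx.
  by rewrite ler_expR ler_wpM2r ?subr_ge0 // lerN2.
have jE : j = i.
  by apply: val_inj => /=; apply: anti_leq; rewrite ij andbT -ltnS subnSK.
have IH' (k : 'I_n) u : (i < k)%N -> t0 <= u -> u <= t ->
    x u ord0 k ^+ 2 <= C * `|x t0| ^+ 2 * expR (- delta * (u - t0)).
  move=> ik tu ut; apply: (IH t0 T x t00 sx) => //.
    by rewrite -(subnSK mn).
  by apply: le_lt_trans tT; rewrite lee_fin.
have := component_decay G L K alpha M C delta delta' p i Gtri Gt G1 G0 L0 GL a0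
  mp pM Jp pK C0 d'0 d'd d'a t0 t x t00 t0t cx dx IH'.
rewrite -/Ci jE => /le_trans; apply.
by rewrite ler_wpM2r ?expR_ge0 // ler_wpM2r // le_max lexx orbT.
Qed.

Lemma class_KL_exp {R : realType} (C delta : R) : 0 < C -> 0 < delta ->
  class_KL (fun s r => C * s * expR (- delta * r)).
Proof.
move=> C0 d0; split.
- by move=> s r s0 _; rewrite !mulr_ge0 ?expR_ge0 // ltW.
- by move=> r _; rewrite mulr0 mul0r.
- by move=> r s1 s2 _ _ s12; rewrite ltr_pM2r ?expR_gt0 // ltr_pM2l.
- move=> s r1 r2 s0 _ r12; rewrite ler_wpM2l ?mulr_ge0 ?(ltW C0) // ler_expR.
  by rewrite !mulNr lerN2 ler_wpM2l // ltW.
- move=> s _; rewrite -[X in _ --> X](mulr0 (C * s)); apply: cvgM;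
  first exact: cvg_cst.
  have -> : (fun r => expR (- delta * r)) = (fun r :
    R => expR (- r)) \o (fun r => delta * r).
    by apply/funext => r /=; rewrite mulNr.
  by apply: cvg_comp (@cvgr_expR R); apply: gt0_cvgMry => //; exact: cvg_id.
Qed.

Theorem corollary1 (R : realType) (n : nat) (hn : (0 < n)%N)
    (G : R -> 'rV[R]_n -> 'rV[R]_n)
    (Gtri : triangular G)
    (G1t : forall x : 'rV[R]_n,
      {within `[0, +oo[, continuous (fun t : R => G t x)})
    (G1x : forall t : R, 0 <= t -> C1 (G t))
    (G2 : forall t : R, 0 <= t -> forall x : 'rV[R]_n, G t x = 0 <-> x = 0)
    (G3 : forall y : R -> 'rV[R]_n, measurable_vector `[0, +oo[ y ->
      exists M : R, forall t : R, 0 <= t -> `|Jac G t (y t)| <= M)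
    (G4 : forall y : R -> 'rV[R]_n, measurable_vector `[0, +oo[ y ->
      ED_spectrum (fun t : R => Jac G t (y t)) `<=` `]-oo, 0[) :
  globally_uniformly_asymptotically_stable G.
Proof.
have G0 (t : R) : 0 <= t -> G t 0 = 0 by move=> t0; exact/(G2 t t0).
have [C [delta [C0 d0 xC]]] := components_decay G Gtri G1t G1x G0 G3 G4 n.
have C1 : 0 < C + 1 by lra.
have d2 : 0 < delta / 2 by rewrite divr_gt0.
exists (fun s r => (C + 1) * s * expR (- (delta / 2) * r)).
split; first exact: class_KL_exp.
move=> t0 T x t00 sx t t0t tT.
have b0 : 0 <= (C + 1) * `|x t0| * expR (- (delta / 2) * (t - t0)).
  by rewrite !mulr_ge0 ?expR_ge0 // ltW.
apply: mx_norm_le => // k j; rewrite (ord1 k).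
rewrite -(@ler_pXn2r _ 2) ?nnegrE // real_normK ?num_real //.
apply: le_trans (xC t0 T x t00 sx t j _ t0t tT) _; first by rewrite subnn.
rewrite !exprMn -expRM_natl.
have -> : 2 * (- (delta / 2) * (t - t0)) = - delta * (t - t0) by field.
rewrite ler_wpM2r ?expR_ge0 // ler_wpM2r ?sqr_ge0 //; nra.
Qed.
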